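(* Let $K\subset\mathbb{R}^n$ be a Euclidean cubical complex with minimal vertex $\mathbf{0}$, i.e. $\mathbf{0}\in K_0$ and $\mathbf{0}\preceq\mathbf{v}$ for every vertex $\mathbf{v}\in K_0$. Suppose that for all $\mathbf{k}\in K_0$ the past link $lk^-_{K,\mathbf{0}}(\mathbf{k})$ is contractible or empty. Then all spaces of directed paths $\overrightarrow{P}_{\mathbf{0}}^{\mathbf{k}}(K)$, $\mathbf{k}\in K_0$, are contractible.
   Context: For $\mathbf{p},\mathbf{q}\in\mathbb{R}^n$ write $\mathbf{p}\preceq\mathbf{q}$ if $p_i\le q_i$ for all $i$, and $[\mathbf{p},\mathbf{q}]=\{\mathbf{x}\in\mathbb{R}^n:\mathbf{p}\preceq\mathbf{x}\preceq\mathbf{q}\}$. If $\mathbf{p},\mathbf{q}\in\mathbb{Z}^n$ and $\mathbf{q}-\mathbf{p}\in\{0,1\}^n$, then $[\mathbf{p},\mathbf{q}]$ is an elementary cube. A Euclidean cubical complex $K\subseteq\mathbb{R}^n$ is a union of elementary cubes; its vertex set $K_0$ is the set of integer points (elementary $0$-cubes) contained in $K$. A directed path (dipath) in $K$ is a continuous map $\alpha:[0,1]\to K$ each of whose coordinate functions is non-decreasing. For $\mathbf{x},\mathbf{y}\in K$, $\overrightarrow{P}_{\mathbf{x}}^{\mathbf{y}}(K)$ is the space of dipaths $\alpha$ in $K$ with $\alpha(0)=\mathbf{x}$ and $\alpha(1)=\mathbf{y}$, with the compact-open topology. Let $\Delta^{n-1}$ be the complete simplicial complex on the vertex set $\{1,\dots,n\}$;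 a simplex $S\subseteq\{1,\dots,n\}$ is identified with its indicator vector $\mathbf{j}\in\{0,1\}^n$ ($\mathbf{j}=\mathbf{0}$ corresponds to the empty simplex). The past link $lk^-_{K,\mathbf{w}}(\mathbf{v})$ of a vertex $\mathbf{v}$ with respect to a vertex $\mathbf{w}$ is the simplicial subcomplex of $\Delta^{n-1}$ given by: $\mathbf{j}\in lk^-_{K,\mathbf{w}}(\mathbf{v})$ if and only if $[\mathbf{v}-\mathbf{j},\mathbf{v}]\subseteq K\cap[\mathbf{w},\mathbf{v}]$. Topological properties of a past link (contractible, empty) refer to its geometric realization; thus the past link is empty when it contains no $\mathbf{j}\ne\mathbf{0}$ (for instance, $lk^-_{K,\mathbf{0}}(\mathbf{0})$ is empty).
   Formalization: As stated this fails for disconnected K (K = {0} ∪ {2} in R: both past links are empty and so is the dipath space from 0 to 2); the formal theorem concludes that each dipath space is contractible or empty, and contractible whenever K is connected. *)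

(* Defs.v *)
From mathcomp Require Import all_boot all_order all_algebra.
From mathcomp Require Import all_classical all_reals topology.
From mathcomp Require Import normedtype.

Set Implicit Arguments.
Unset Strict Implicit.
Unset Printing Implicit Defensive.

Import Order.TTheory GRing.Theory Num.Theory.
Import numFieldNormedType.Exports.
Local Open Scope classical_set_scope.
Local Open Scope ring_scope.

Section Contractibility.
Variable R : realType.

(* Used through the coercion of sets to types, whose topology is the
   subspace topology. *)
Definition unit_itv : set R := `[0, 1]%classic.

Lemma unit_itv0 : 0 \in unit_itv.
Proof. by rewrite inE /unit_itv /= in_itv /= lexx ler01. Qed.

Lemma unit_itv1 : 1 \in unit_itv.
Proof. by rewrite inE /unit_itv /= in_itv /= lexx ler01. Qed.

Definition I0 : unit_itv := exist _ 0 unit_itv0.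
Definition I1 : unit_itv := exist _ 1 unit_itv1.

Definition empty_space (X : topologicalType) : Prop := X -> False.

(* The centre c makes a contractible space nonempty. *)
Definition contractible (X : topologicalType) : Prop :=
  exists (c : X) (H : X * unit_itv -> X),
    [/\ continuous H,
        forall x, H (x, I0) = x &
        forall x, H (x, I1) = c].

End Contractibility.

Arguments unit_itv R : clear implicits.
Arguments I0 R : clear implicits.
Arguments I1 R : clear implicits.
Arguments contractible R X : clear implicits.

Section CubicalComplexes.
Variables (R : realType) (n : nat).

Definition box (p q : 'rV[R]_n) : set 'rV[R]_n :=
  [set x | forall i, p 0 i <= x 0 i <= q 0 i].

Definition embZ (p : 'rV[int]_n) : 'rV[R]_n := map_mx intr p.

Definition elementary (p q : 'rV[int]_n) : Prop :=
  forall i, q 0 i - p 0 i = 0 \/ q 0 i - p 0 i = 1.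

Definition cubical_complex (K : set 'rV[R]_n) : Prop :=
  exists C : set ('rV[int]_n * 'rV[int]_n),
    (forall c, C c -> elementary c.1 c.2) /\
    K = \bigcup_(c in C) box (embZ c.1) (embZ c.2).

Definition vertices (K : set 'rV[R]_n) : set 'rV[int]_n :=
  [set v | K (embZ v)].

Definition minimal_vertex (K : set 'rV[R]_n) (w : 'rV[int]_n) : Prop :=
  vertices K w /\ forall v, vertices K v -> forall i, w 0 i <= v 0 i.

Definition dipaths (K : set 'rV[R]_n) (x y : 'rV[R]_n) :
    set {compact-open, unit_itv R -> K} :=
  [set a | [/\ continuous (a : unit_itv R -> K),
      forall i (s t : unit_itv R), \val s <= \val t ->
        (\val (a s) : 'rV[R]_n) 0 i <= (\val (a t) : 'rV[R]_n) 0 i,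
      \val (a (I0 R)) = x &
      \val (a (I1 R)) = y]].

Definition indicator (J : {set 'I_n}) : 'rV[int]_n :=
  \row_i (i \in J)%:R.

(* A simplicial complex is given by its set of simplices. *)
Definition past_link (K : set 'rV[R]_n) (w v : 'rV[int]_n) :
    set {set 'I_n} :=
  [set J | box (embZ (v - indicator J)) (embZ v)
             `<=` K `&` box (embZ w) (embZ v)].

(* Barycentric coordinates, with the subspace topology of R^n. Since the
   coordinates sum to 1, the empty simplex contributes no point. *)
Definition realization (L : set {set 'I_n}) : set 'rV[R]_n :=
  [set t | [/\ forall i, 0 <= t 0 i,
      \sum_i t 0 i = 1 &
      L [set i | t 0 i != 0]%SET]].

End CubicalComplexes.

Arguments embZ R {n} p.
Arguments dipaths {R n} K x y.
Arguments realization R {n} L.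

(* Main.v *)
Require Import Defs.
From mathcomp Require Import all_boot all_order all_algebra.
From mathcomp Require Import all_classical all_reals topology.
From mathcomp Require Import normedtype.
From mathcomp Require Import ring lra zify.
Import Order.TTheory GRing.Theory Num.Theory.
Import numFieldNormedType.Exports.
Local Open Scope classical_set_scope.
Local Open Scope ring_scope.

Set Implicit Arguments.
Unset Strict Implicit.
Unset Printing Implicit Defensive.

(** A dipath ending at v passes through a unique point at depth 1/2 below v in
    the l1 distance. Scaled by 2, its offset from v is a point phi of the
    realization of the past link L of v, and the dipath can be truncated below
    v - S for every S contained in the carrier of phi: the straight homotopy to
    the truncation, extended by segments from v - S towards v, stays in K. So the
    open stars of L pull back to a cover of the dipath space whose members
    deform onto the dipath spaces of the vertices v - S. The latter are
    contractible by induction, and contractibility of L then gives that of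
    the dipath space, as in Dold's proof of the nerve theorem.
    Contractibility is used as an extension property: a family of dipaths over
    {w < 1} agrees over {w <= 0} with a family defined everywhere. The
    induction also needs every vertex v - S to be reachable as soon as v is;
    this holds because L is connected. *)

(** * Pointwise continuity of real functions *)

Section RealContinuity.
Context {R : realType} {T : topologicalType}.
Implicit Types (u v : T -> R) (z : T).

Definition contR z u := {for z, continuous u}.

Lemma contR_cst z (c : R) : contR z (fun=> c).
Proof. exact: cst_continuous. Qed.

Lemma contRD z u v : contR z u -> contR z v -> contR z (fun x => u x + v x).
Proof. by move=> cu cv; apply: (@continuousD _ R _ u v). Qed.

Lemma contRN z u : contR z u -> contR z (fun x => - u x).
Proof. by move=> cu; apply: (@continuousN _ R _ u). Qed.

Lemma contRB z u v : contR z u -> contR z v -> contR z (fun x => u x - v x).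
Proof. by move=> cu cv; apply: contRD => //; exact: contRN. Qed.

Lemma contRM z u v : contR z u -> contR z v -> contR z (fun x => u x * v x).
Proof. by move=> cu cv; apply: (@continuousM _ _ u v). Qed.

Lemma contRV z u : u z != 0 -> contR z u -> contR z (fun x => (u x)^-1).
Proof. by move=> uz cu; apply: continuousV. Qed.

Lemma contR_min z u v :
  contR z u -> contR z v -> contR z (fun x => Num.min (u x) (v x)).
Proof. by move=> cu cv; apply: (@continuous_min _ _ u v). Qed.

Lemma contR_max z u v :
  contR z u -> contR z v -> contR z (fun x => Num.max (u x) (v x)).
Proof. by move=> cu cv; apply: (@continuous_max _ _ u v). Qed.

Lemma contR_sum (I : Type) (r : seq I) (P : pred I) (F : I -> T -> R) z :
  (forall i, P i -> contR z (F i)) ->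
  contR z (fun x => \sum_(i <- r | P i) F i x).
Proof.
by move=> FC; apply: (@cvg_big R I +%R) => //; exact: add_continuous.
Qed.

Lemma contR_prod (I : Type) (r : seq I) (P : pred I) (F : I -> T -> R) z :
  (forall i, P i -> contR z (F i)) ->
  contR z (fun x => \prod_(i <- r | P i) F i x).
Proof.
by move=> FC; apply: (@cvg_big R I *%R) => //; exact: mul_continuous.
Qed.

Lemma contR_near z u v : (\forall x \near z, u x = v x) -> contR z v -> contR z u.
Proof.
move=> uv cv; have uvz := nbhs_singleton uv.
by rewrite /contR /prop_for /continuous_at uvz; apply: cvg_trans cv;
  apply: near_eq_cvg; near=> x; apply/esym; near: x.
Unshelve. all: by end_near. Qed.

Lemma contR_ext z u v : u =1 v -> contR z v -> contR z u.
Proof. by move=> uv; apply: contR_near; exact: nearW. Qed.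

Lemma near_lt z u v : contR z u -> contR z v -> u z < v z ->
  \forall x \near z, u x < v x.
Proof.
move=> cu cv uvz.
have := contRB cv cu; rewrite /contR /prop_for /continuous_at => /cvgr_gt.
move=> /(_ 0); rewrite subr_gt0 => /(_ uvz); apply: filterS => x /=.
by rewrite subr_gt0.
Qed.

End RealContinuity.

Lemma contR_comp {R : realType} {S T : topologicalType} (h : S -> T)
    (u : T -> R) (z : S) :
  {for z, continuous h} -> contR (h z) u -> contR z (fun x => u (h x)).
Proof. exact: continuous_comp. Qed.

Lemma contR_fst {R : realType} {S T : topologicalType} (u : S -> R) (p : S * T) :
  contR p.1 u -> contR p (fun q => u q.1).
Proof. by move=> cu; apply: (@contR_comp R _ _ fst u) => //; exact: cvg_fst. Qed.

Lemma contR_snd {R : realType} {S : topologicalType} (p : S * R) :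
  contR p (fun q => q.2).
Proof. exact: cvg_snd. Qed.

(** This is the form used to reparametrise time in a family: the new time [h] may depend on the
    parameter as well as on the old time. *)
Lemma contR_subst {R : realType} {S : topologicalType} (F : S -> R -> R)
    (h : S * R -> R) (p : S * R) :
  contR p h -> contR (p.1, h p) (fun q => F q.1 q.2) ->
  contR p (fun q => F q.1 (h q)).
Proof.
move=> ch cF; apply: (@contR_comp R _ _ (fun q => (q.1, h q)) (fun q => F q.1 q.2))
  => //.
exact: (@cvg_pair _ _ _ (nbhs p) (nbhs p.1) (nbhs (h p)) _ _ _ fst h
  (@cvg_fst _ _ _ _ _) ch).
Qed.

Lemma contR_slice {R : realType} {S : topologicalType} (F : S -> R -> R)
    (z : S) (t : R) :
  contR (z, t) (fun q => F q.1 q.2) -> contR z (F^~ t).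
Proof.
move=> cF; apply: (@contR_comp R _ _ (fun x => (x, t)) (fun q => F q.1 q.2))
  => //.
exact: (@cvg_pair _ _ _ (nbhs z) (nbhs z) (nbhs t) _ _ _ id (fun=> t)
  (@cvg_id _ _) (@cvg_cst _ _ _ _ _)).
Qed.

Lemma contR_path {R : realType} {S : topologicalType} (F : S -> R -> R)
    (z : S) (t : R) :
  contR (z, t) (fun q => F q.1 q.2) -> contR t (F z).
Proof.
move=> cF; apply: (@contR_comp R _ _ (fun s => (z, s)) (fun q => F q.1 q.2))
  => //.
exact: (@cvg_pair _ _ _ (nbhs t) (nbhs z) (nbhs t) _ _ _ (fun=> z) id
  (@cvg_cst _ _ _ _ _) (@cvg_id _ _)).
Qed.

Section Clamp.
Context {R : realType}.

Definition clamp (b x : R) : R := Num.min b (Num.max 0 x).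

Lemma clamp_itv b x : 0 <= b -> 0 <= clamp b x <= b.
Proof.
by rewrite /clamp !minElt !maxElt; do !case: ifPn; rewrite -?leNgt => *; lra.
Qed.

Lemma clamp_le b x y : x <= y -> clamp b x <= clamp b y.
Proof.
by rewrite /clamp !minElt !maxElt; do !case: ifPn; rewrite -?leNgt => *; lra.
Qed.

Lemma clamp_low b x : 0 <= b -> x <= 0 -> clamp b x = 0.
Proof.
by rewrite /clamp !minElt !maxElt; do !case: ifPn; rewrite -?leNgt => *; lra.
Qed.

Lemma clamp_high b x : 0 <= b -> b <= x -> clamp b x = b.
Proof.
by rewrite /clamp !minElt !maxElt; do !case: ifPn; rewrite -?leNgt => *; lra.
Qed.

Lemma clamp_mid b x : 0 <= x <= b -> clamp b x = x.
Proof.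
by rewrite /clamp !minElt !maxElt; do !case: ifPn; rewrite -?leNgt => *; lra.
Qed.

Lemma contR_clamp {T : topologicalType} (z : T) (b u : T -> R) :
  contR z b -> contR z u -> contR z (fun x => clamp (b x) (u x)).
Proof.
by move=> cb cu; apply: contR_min => //; apply: contR_max => //; exact: contR_cst.
Qed.

End Clamp.

(** * Dipaths and their truncations *)

Section Paths.
Context {R : realType} {n : nat}.
Implicit Types (K : set 'rV[R]_n) (x y : 'rV[R]_n) (u v : 'rV[int]_n).
Implicit Types (a b : R -> 'rV[R]_n).

Definition cap u x : 'rV[R]_n := \row_i Num.min (x 0 i) (u 0 i)%:~R.

(** Asking for the whole box, rather than just the segment from [x] to [cap u x], makes the
    condition pass to higher [u] ([good_le]) and survive the straight homotopy ([good_mix]). *)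
Definition good K u x := box (cap u x) x `<=` K.

(* Dipaths are parametrised by the whole line and constant outside [0, 1]. *)
Definition dipath K v a :=
  [/\ forall t, K (a t),
      forall i s t, s <= t -> a s 0 i <= a t 0 i,
      forall t, t <= 0 -> a t = 0 &
      forall t, 1 <= t -> a t = embZ R v].

(** Continuity is joint in parameter and time, and is tested in the ambient [Z]; it is the usual
    continuity over [D] when [D] is open. *)
Definition dipath_family K v {Z : topologicalType} (D : set Z)
    (f : Z -> R -> 'rV[R]_n) :=
  (forall z, D z -> dipath K v (f z)) /\
  (forall z t i, D z -> contR (z, t) (fun p => f p.1 p.2 0 i)).

Definition extend u v b t : 'rV[R]_n :=
  \row_i (b (2 * t) 0 i + clamp 1 (2 * t - 1) * (v 0 i - u 0 i)%:~R).

(* At tau = 0 the path itself; at tau = 1 its truncation below u, followed by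
   the segment from u to v. *)
Definition deform u v (tau : R) a t : 'rV[R]_n :=
  \row_i ((1 - tau) * a ((1 + tau) * t) 0 i
          + tau * cap u (a ((1 + tau) * t)) 0 i
          + clamp tau ((1 + tau) * t - 1) * (v 0 i - u 0 i)%:~R).

Lemma dipath_itv K v a t i : dipath K v a -> 0 <= a t 0 i <= (v 0 i)%:~R.
Proof.
case=> _ am a0 a1.
(* The times [Num.min t 0] and [Num.max t 1] surround [t] and lie where the path is constant. *)
have := am i (Num.min t 0) t; have := am i t (Num.max t 1).
rewrite (a0 (Num.min t 0)) ?(a1 (Num.max t 1)) ?ge_min ?le_max ?lexx ?orbT // !mxE.
by move=> /(_ isT) -> /(_ isT) ->.
Qed.

Lemma good_le K u u' x : (forall i, u 0 i <= u' 0 i) -> good K u x -> good K u' x.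
Proof.
move=> uu' gx y yb; apply: gx => i; have /andP[h ->] := yb i.
rewrite andbT (le_trans _ h) // !mxE le_min ge_min lexx /=.
by rewrite ge_min ler_int uu' orbT.
Qed.

Lemma good_mem K u x : good K u x -> K x.
Proof. by apply=> i; rewrite mxE ge_min lexx. Qed.

Lemma good_mem_cap K u x : good K u x -> K (cap u x).
Proof. by apply=> i; rewrite mxE lexx ge_min lexx. Qed.

Lemma cap_id u x : (forall i, x 0 i <= (u 0 i)%:~R) -> cap u x = x.
Proof. by move=> xu; apply/rowP => i; rewrite mxE min_l. Qed.

Lemma good_low K u x : K x -> (forall i, x 0 i <= (u 0 i)%:~R) -> good K u x.
Proof.
move=> Kx xu y; rewrite cap_id // => yb.
suff -> : y = x by [].
by apply/rowP => i; apply/eqP; rewrite eq_le andbC yb.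
Qed.

Lemma cap_dipath K u v a : (forall i, 0 <= u 0 i <= v 0 i) ->
  (forall t, good K u (a t)) -> dipath K v a -> dipath K u (fun t => cap u (a t)).
Proof.
move=> uv ga [aK am a0 a1]; split=> [t|i s t st|t t0|t t1].
- exact: good_mem_cap.
- by rewrite !mxE le_min !ge_min (am i s t st) lexx orbT.
- rewrite (a0 t t0); apply: cap_id => i; rewrite !mxE ler0z.
  by case/andP: (uv i).
- apply/rowP => i; rewrite (a1 t t1) !mxE; apply: min_r; rewrite ler_int.
  by case/andP: (uv i).
Qed.

Lemma deform0 u v a : deform u v 0 a = a.
Proof.
apply/funext => t; apply/rowP => i; rewrite !mxE addr0 subr0 !mul1r mul0r addr0.
have /le_anti/esym -> : 0 <= clamp 0 (t - 1) <= 0 by exact: clamp_itv.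
by rewrite mul0r addr0.
Qed.

Lemma deform1 u v a : deform u v 1 a = extend u v (fun t => cap u (a t)).
Proof.
by apply/funext => t; apply/rowP => i; rewrite !mxE subrr mul0r add0r mul1r.
Qed.

Section Deform.
Variables (K : set 'rV[R]_n) (u v : 'rV[int]_n).
Hypothesis uv : forall i, 0 <= u 0 i <= v 0 i.
Hypothesis uvK : box (embZ R u) (embZ R v) `<=` K.

Let uvR i : (u 0 i)%:~R <= ((v 0 i)%:~R : R).
Proof. by rewrite ler_int; case/andP: (uv i). Qed.

Lemma good_box x :
  (forall i, (u 0 i)%:~R <= x 0 i <= (v 0 i)%:~R) -> good K u x.
Proof.
move=> xuv y yb; apply: uvK => i; rewrite !mxE.
have := yb i; rewrite mxE; have /andP[xu xv] := xuv i.
by rewrite min_r // => /andP[-> /le_trans ->].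
Qed.

(** Coordinates at most [u i] do not move, and the others stay between [u i] and [x i]. So the
    truncation of the mixed point is that of [x], and its box is contained in the box of [x]. *)
Lemma good_mix x (tau : R) : 0 <= tau <= 1 -> good K u x ->
  good K u (\row_i ((1 - tau) * x 0 i + tau * cap u x 0 i)).
Proof.
move=> t01 gx y yb; apply: gx => i; move: (yb i).
rewrite !mxE; case: (leP (x 0 i) _) => h; last first.
  rewrite min_r; last by nra.
  by move=> /andP[-> hy]; rewrite (le_trans hy) //; nra.
rewrite -mulrDl subrK mul1r; by rewrite min_l.
Qed.

Lemma extendE b t i : dipath K u b -> extend u v b t 0 i =
  if 2 * t <= 1 then b (2 * t) 0 i
  else (u 0 i)%:~R + clamp 1 (2 * t - 1) * (v 0 i - u 0 i)%:~R.
Proof.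
move=> [_ _ _ b1]; rewrite mxE; case: ifPn => [t1|].
  by rewrite clamp_low ?ler01 ?subr_le0 // mul0r addr0.
by rewrite -ltNge => /ltW t1; rewrite b1 // mxE.
Qed.

(** In the first half the path is below [u], where truncation does nothing; in the second half it
    runs inside the cube from [u] to [v]. *)
Lemma dipath_extend b : dipath K u b ->
  dipath K v (extend u v b) /\ forall t, good K u (extend u v b t).
Proof.
move=> db; have [bK bm b0 b1] := db.
have ge t : good K u (extend u v b t).
  have [t1|t1] := leP (2 * t) 1.
    have -> : extend u v b t = b (2 * t).
      by apply/rowP => i; rewrite extendE // t1.
    by apply: good_low => // i; case/andP: (dipath_itv (2 * t) i db).
  apply: good_box => i; rewrite extendE // [2 * t <= 1]leNgt t1 /=.
  have := clamp_itv (2 * t - 1) (@ler01 R); have := uvR i.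
  by rewrite intrB; nra.
split=> //; split=> [t|i s t st|t t0|t t1]; first exact: good_mem.
- rewrite !mxE lerD //; first by apply: bm; lra.
  by apply: ler_wpM2r; [rewrite ler0z subr_ge0; case/andP: (uv i)|
    apply: clamp_le; lra].
- apply/rowP => i; rewrite mxE b0; last lra.
  by rewrite clamp_low ?mul0r ?addr0 //; lra.
- apply/rowP => i; rewrite mxE b1; last lra.
  by rewrite clamp_high ?mul1r ?mxE; [rewrite intrB addrC subrK|lra|lra].
Qed.

(** While [(1 + tau) * t <= 1] the point is a mix of [a] and its truncation. Later [a] rests at [v],
    so the mix rests at [v - tau (v - u)], and the last term climbs the missing [tau (v - u)] inside
    the cube. *)
Lemma dipath_deform a (tau : R) : 0 <= tau <= 1 ->
  (forall t, good K u (a t)) -> dipath K v a ->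
  dipath K v (deform u v tau a) /\ forall t, good K u (deform u v tau a t).
Proof.
move=> /andP[tau0 tau1] ga da; have [aK am a0 a1] := da.
have ge t : good K u (deform u v tau a t).
  have [t1|t1] := leP ((1 + tau) * t) 1.
    have -> : deform u v tau a t =
        \row_i ((1 - tau) * a ((1 + tau) * t) 0 i
                + tau * cap u (a ((1 + tau) * t)) 0 i).
      by apply/rowP => i; rewrite [LHS]mxE clamp_low ?subr_le0 // mul0r addr0 [RHS]mxE.
    by apply: good_mix; rewrite ?tau0 ?tau1.
  apply: good_box => i; rewrite !mxE a1 ?(ltW t1) // mxE min_r //.
  have := clamp_itv ((1 + tau) * t - 1) tau0; have := uvR i.
  by rewrite intrB; nra.
split=> //; split=> [t|i s t st|t t0|t t1]; first exact: good_mem.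
- have h : (1 + tau) * s <= (1 + tau) * t by nra.
  have [_ cm _ _] := cap_dipath uv ga da.
  rewrite [leLHS]mxE [leRHS]mxE !lerD //.
  + by apply: ler_wpM2l; [lra | exact: am].
  + by apply: ler_wpM2l => //; exact: cm.
  by apply: ler_wpM2r; [rewrite ler0z subr_ge0; case/andP: (uv i)|
    apply: clamp_le; lra].
- have h : (1 + tau) * t <= 0 by nra.
  have [_ _ c0 _] := cap_dipath uv ga da.
  apply/rowP => i; rewrite mxE c0 // a0 //.
  by rewrite clamp_low //; [rewrite mul0r !mxE !mulr0 !addr0|lra].
- have h : 1 + tau <= (1 + tau) * t by nra.
  apply/rowP => i; rewrite !mxE a1; last lra.
  rewrite mxE min_r // clamp_high //; last lra.
  by rewrite intrB; lra.
Qed.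

End Deform.
End Paths.

Section Families.
Context {R : realType} {n : nat} (K : set 'rV[R]_n) (u v : 'rV[int]_n).
Hypothesis uv : forall i, 0 <= u 0 i <= v 0 i.
Context {Z : topologicalType} (D : set Z).

Lemma contR_cap (f : Z -> R -> 'rV[R]_n) z t i :
  contR (z, t) (fun p => f p.1 p.2 0 i) ->
  contR (z, t) (fun p => cap u (f p.1 p.2) 0 i).
Proof.
move=> cf; apply: contR_ext => [p|]; first exact: mxE.
by apply: contR_min => //; exact: contR_cst.
Qed.

Lemma cap_family f : dipath_family K v D f ->
  (forall z t, D z -> good K u (f z t)) ->
  dipath_family K u D (fun z t => cap u (f z t)).
Proof.
move=> [df cf] gf; split=> [z Dz|z t i Dz].
  by apply: (cap_dipath uv _ (df _ Dz)) => t; exact: gf.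
by apply: contR_cap; exact: cf.
Qed.

Lemma contR_extend (f : Z -> R -> 'rV[R]_n) z t i :
  (forall t i, contR (z, t) (fun p => f p.1 p.2 0 i)) ->
  contR (z, t) (fun p => extend u v (f p.1) p.2 0 i).
Proof.
move=> cf; apply: contR_ext => [p|]; first exact: mxE.
have c2 : contR (z, t) (fun p => 2 * p.2).
  by apply: contRM; [exact: contR_cst|exact: contR_snd].
apply: contRD.
  by apply: (contR_subst (F := fun z t => f z t 0 i)) => //; exact: cf.
apply: contRM; last exact: contR_cst.
apply: contR_clamp; first exact: contR_cst.
by apply: contRB => //; exact: contR_cst.
Qed.

Lemma contR_deform (f : Z -> R -> 'rV[R]_n) (tau : Z -> R) z t i :
  contR z tau ->
  (forall t i, contR (z, t) (fun p => f p.1 p.2 0 i)) ->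
  contR (z, t) (fun p => deform u v (tau p.1) (f p.1) p.2 0 i).
Proof.
move=> ctau cf; apply: contR_ext => [p|]; first exact: mxE.
have ct : contR (z, t) (fun p => tau p.1) by apply: contR_fst.
have c2 : contR (z, t) (fun p => (1 + tau p.1) * p.2).
  apply: contRM; last exact: contR_snd.
  by apply: contRD => //; exact: contR_cst.
apply: contRD; first apply: contRD.
- apply: contRM; first by apply: contRB => //; exact: contR_cst.
  by apply: (contR_subst (F := fun z t => f z t 0 i)) => //; exact: cf.
- apply: contRM => //.
  apply: (contR_subst (F := fun z t => cap u (f z t) 0 i)) => //.
  by apply: contR_cap; exact: cf.
apply: contRM; last exact: contR_cst.
apply: contR_clamp => //.
by apply: contRB => //; exact: contR_cst.
Qed.

End Families.

(** * Past links and the point at depth 1/2 *)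

Section PastLinks.
Context {R : realType} {n : nat}.
Variable K : set 'rV[R]_n.
Hypothesis K_cubical : cubical_complex K.
Hypothesis K_min : minimal_vertex K 0.
Implicit Types (x y : 'rV[R]_n) (v : 'rV[int]_n) (S : {set 'I_n}).

(** An elementary cube containing [x] has integer corners, so it contains the smallest integer box
    around [x]. *)
Lemma carrier_sub x y : K x ->
  (forall i, (Num.floor (x 0 i))%:~R <= y 0 i <= (Num.ceil (x 0 i))%:~R) -> K y.
Proof.
case: K_cubical => C [_ ->] [c Cc xc] yx; exists c => // i.
have := xc i; rewrite !mxE => /andP[px xq]; have /andP[ly yu] := yx i.
apply/andP; split.
  by apply: le_trans ly; rewrite ler_int floor_ge_int.
by apply: le_trans yu _; rewrite ler_int ceil_le_int.
Qed.

Definition lower v S : 'rV[int]_n := v - indicator S.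

Lemma lowerE v S i : lower v S 0 i = v 0 i - (i \in S)%:R.
Proof. by rewrite !mxE. Qed.

Lemma lower_if v S i :
  (lower v S 0 i)%:~R = (if i \in S then (v 0 i)%:~R - 1 else (v 0 i)%:~R) :> R.
Proof. by rewrite lowerE intrB; case: (i \in S) => //=; rewrite subr0. Qed.

Lemma lower_le v S i : lower v S 0 i <= v 0 i.
Proof. by rewrite lowerE gerBl; case: (_ \in _). Qed.

Lemma lower_sub v S S' i : S' \subset S -> lower v S 0 i <= lower v S' 0 i.
Proof.
move=> /fintype.subsetP SS; rewrite !lowerE lerD2l lerN2.
by case: (boolP (i \in S')) => [/SS ->|_]; last case: (_ \in _).
Qed.

Lemma link_box v S : past_link K 0 v S ->
  box (embZ R (lower v S)) (embZ R v) `<=` K.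
Proof. by move=> L x /L[]. Qed.

Lemma vertex_ge0 v i : vertices K v -> 0 <= v 0 i.
Proof. by case: K_min => _ /[apply] /(_ i); rewrite mxE. Qed.

Lemma box_lower_vertex v S : box (embZ R (lower v S)) (embZ R v) `<=` K ->
  vertices K (lower v S).
Proof. by apply=> i; rewrite ![embZ _ _ _ _]mxE lexx ler_int lower_le. Qed.

(** Containment in the box from 0 to [v] comes from minimality of 0, since the lower corner is a
    vertex of [K]. *)
Lemma box_link v S : box (embZ R (lower v S)) (embZ R v) `<=` K ->
  past_link K 0 v S.
Proof.
move=> bK x xb; split; first exact: bK.
move=> i; have /andP[lx ->] := xb i; rewrite andbT (le_trans _ lx) //.
by rewrite [leLHS]mxE [leRHS]mxE mxE ler_int vertex_ge0 //; exact: box_lower_vertex.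
Qed.

Lemma link_vertex v S : past_link K 0 v S -> vertices K (lower v S).
Proof. by move=> /link_box/box_lower_vertex. Qed.

Lemma link_lower v S : past_link K 0 v S ->
  forall i, 0 <= lower v S 0 i <= v 0 i.
Proof. by move=> L i; rewrite lower_le vertex_ge0 //; exact: link_vertex. Qed.

Lemma link_sub v S S' : S' \subset S -> past_link K 0 v S -> past_link K 0 v S'.
Proof.
move=> SS /link_box bK; apply: box_link => x xb; apply: bK => i.
have := xb i; rewrite ![embZ _ _ _ _]mxE => /andP[lx ->]; rewrite andbT.
by apply: le_trans lx; rewrite ler_int lower_sub.
Qed.

Definition depth v x : R := \sum_i ((v 0 i)%:~R - x 0 i).

Definition bary v x : 'rV[R]_n := \row_i (2 * ((v 0 i)%:~R - x 0 i)).

Definition carrier (t : 'rV[R]_n) : {set 'I_n} := [set i | t 0 i != 0]%SET.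

Lemma mem_carrier_bary v x i :
  (i \in carrier (bary v x)) = (x 0 i != (v 0 i)%:~R).
Proof. by rewrite finset.inE mxE mulf_eq0 pnatr_eq0 subr_eq0 [_ == x 0 i]eq_sym. Qed.

Section Crossing.
Variables (v : 'rV[int]_n) (a : R -> 'rV[R]_n) (t0 : R).
Hypothesis da : dipath K v a.
Hypothesis ca : depth v (a t0) = 2^-1.

Lemma crossing_itv i : (v 0 i)%:~R - 2^-1 <= a t0 0 i <= (v 0 i)%:~R.
Proof.
have /andP[_ ->] := dipath_itv t0 i da; rewrite andbT.
rewrite lerBlDl -lerBlDr -ca /depth (bigD1 i) //= lerDl.
by apply: sumr_ge0 => j _; rewrite subr_ge0; case/andP: (dipath_itv t0 j da).
Qed.

(** At depth 1/2 every coordinate is within 1/2 of [v]. It rounds up to [v i], and rounds down below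
    [v i] exactly when it differs from [v i]. So the cube spanned by the carrier is contained in the
    smallest cube around the crossing point. *)
Lemma crossing_link : past_link K 0 v (carrier (bary v (a t0))).
Proof.
have [aK _ _ _] := da.
apply: box_link => y yb; apply: carrier_sub (aK t0) _ => i.
have := yb i; have /andP[h1 h2] := crossing_itv i.
rewrite ![embZ _ _ _ _]mxE lowerE mem_carrier_bary => /andP[ly yu]; apply/andP; split.
  apply: le_trans ly; rewrite ler_int.
  case: eqP => [->|/eqP ne]; first by rewrite intrKfloor subr0.
  by rewrite lerBrDr -ltzD1 ltrD2r floor_lt_int lt_neqAle ne.
apply: le_trans yu _; rewrite ler_int.
by rewrite -ltzD1 -ltrBlDr ceil_gt_int intrB; lra.
Qed.

Lemma crossing_realization :
  realization R (past_link K 0 v) (bary v (a t0)).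
Proof.
split; last exact: crossing_link.
  by move=> i; rewrite mxE mulr_ge0 // subr_ge0; case/andP: (crossing_itv i).
under eq_bigr do rewrite mxE.
by rewrite -mulr_sumr -/(depth v (a t0)) ca divff ?pnatr_eq0.
Qed.

(* Before the crossing the cell of a t has room below it in the directions of
   S; after it a t lies in the cube spanned by the carrier. *)
Lemma crossing_good S t :
  S \subset carrier (bary v (a t0)) -> good K (lower v S) (a t).
Proof.
move=> ST; have [aK am _ _] := da.
have [tt0|tt0] := leP t t0.
  move=> y yb; apply: carrier_sub (aK t) _ => i.
  have := yb i; rewrite mxE => /andP[ly yu]; apply/andP; split; last first.
    by rewrite (le_trans yu) // ceil_ge.
  apply: le_trans ly; rewrite le_min floor_le ler_int lowerE /=.
  have /andP[_ av] := dipath_itv t i da.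
  case: (boolP (i \in S)) => iS; last first.
    by rewrite subr0 -ltzD1 floor_lt_int intrD; lra.
  rewrite lerBrDr -ltzD1 ltrD2r floor_lt_int.
  have : i \in carrier (bary v (a t0)) by apply: (fintype.subsetP ST).
  rewrite mem_carrier_bary => ne.
  have := am i _ _ tt0; have /andP[_] := crossing_itv i.
  by move: ne; rewrite neq_lt => /orP[]; lra.
move=> y yb; apply: (link_box crossing_link) => i.
have := yb i; have := am i _ _ (ltW tt0); have /andP[h1 h2] := crossing_itv i.
have /andP[_ av] := dipath_itv t i da.
rewrite ![embZ _ _ _ _]mxE mxE !lower_if mem_carrier_bary ge_min.
have := fintype.subsetP ST i; rewrite mem_carrier_bary.
case: (boolP (i \in S)) => iS; last first.
  case: eqP => [->|_] /= _ h /andP[/orP[h3|h3] h4]; apply/andP; split; lra.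
by move=> /(_ isT) -> /= h /andP[/orP[h3|h3] h4]; apply/andP; split; lra.
Qed.

End Crossing.

End PastLinks.

Section Crossings.
Context {R : realType} {n : nat}.
Variable K : set 'rV[R]_n.
Implicit Types (v : 'rV[int]_n) (a : R -> 'rV[R]_n).

(** All coordinates move in the same direction, so the change of depth is the sum of their changes
    and dominates each of them. In particular two points of a dipath at equal depth coincide. *)
Lemma dipath_dist v a s t i : dipath K v a ->
  `|a s 0 i - a t 0 i| <= `|depth v (a s) - depth v (a t)|.
Proof.
wlog st : s t / s <= t.
  move=> wl da; have [/wl|/ltW/wl] := leP s t; first exact.
  by rewrite distrC [leRHS]distrC; apply.
move=> [_ am _ _]; rewrite /depth -sumrB.
have E j : (v 0 j)%:~R - a s 0 j - ((v 0 j)%:~R - a t 0 j) = a t 0 j - a s 0 j.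
  by ring.
under eq_bigr do rewrite E.
rewrite distrC ger0_norm ?subr_ge0 ?am // ger0_norm; last first.
  by apply: sumr_ge0 => j _; rewrite subr_ge0 am.
by rewrite (bigD1 i) //= lerDl; apply: sumr_ge0 => j _; rewrite subr_ge0 am.
Qed.

Lemma crossing_exists v a : dipath K v a -> v != 0 -> (forall i, 0 <= v 0 i) ->
  (forall i t, contR t (fun t => a t 0 i)) ->
  exists t, depth v (a t) = 2^-1.
Proof.
move=> [_ _ a0 a1] v0 vge0 ca.
have cd : continuous (fun t => depth v (a t)).
  move=> t; apply: contR_sum => i _; apply: contRB; first exact: contR_cst.
  exact: ca.
(* The depth of 0 is the sum of the coordinates of [v], which are nonnegative integers and not all
   zero. *)
have d0 : 1 <= depth v (a 0).
  have [i vi] : exists i, v 0 i != 0.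
    apply/existsP; move: v0; apply: contra_neqT => /existsPn v0.
    by apply/rowP => i; rewrite mxE; apply/eqP/negPn; exact: v0.
  rewrite a0 // /depth (bigD1 i) //= mxE subr0.
  have : 0 <= \sum_(j | j != i) ((v 0 j)%:~R - (0 : 'rV[R]_n) 0 j).
    by apply: sumr_ge0 => j _; rewrite mxE subr0 ler0z.
  have : 1 <= (v 0 i)%:~R :> R.
    by rewrite ler1z -gtz0_ge1 lt_neqAle eq_sym vi vge0.
  lra.
have d1 : depth v (a 1) = 0.
  by rewrite a1 // /depth big1 // => i _; rewrite mxE subrr.
have [||t _ ht] := @IVT R (fun t => depth v (a t)) 0 1 2^-1 ler01.
- exact: continuous_subspaceT.
- rewrite d1 ge_min le_max; apply/andP; split; apply/orP; [right|left]; lra.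
by exists t.
Qed.

(** The crossing time need not be unique, as a dipath may pause, but the point is; hence a time is
    chosen and only the point is kept. *)
Definition crossing v a : 'rV[R]_n := a (xget 0 [set t | depth v (a t) = 2^-1]).

Lemma crossingP v a : (exists t, depth v (a t) = 2^-1) ->
  exists2 t, depth v (a t) = 2^-1 & crossing v a = a t.
Proof.
by move=> /(xgetPex 0) ht; eexists; [exact: ht|].
Qed.

(** Fix a crossing time [t0] for [z]. For nearby [x] the crossing point differs from [f x t0] in
    each coordinate by at most the error [e x] in depth at [t0], which tends to 0; the crossing
    times themselves may jump. *)
Lemma crossing_contR {Z : topologicalType} (D : set Z) v f z i : open D ->
  dipath_family K v D f -> v != 0 -> (forall i, 0 <= v 0 i) -> D z ->
  contR z (fun x => crossing v (f x) 0 i).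
Proof.
move=> oD [df cf] v0 vge0 Dz.
have ex x : D x -> exists2 t, depth v (f x t) = 2^-1 & crossing v (f x) = f x t.
  move=> Dx; apply/crossingP/(crossing_exists (df _ Dx)) => // j t.
  by apply: (contR_path (F := fun z t => f z t 0 j)); exact: cf.
have [t0 ht0 hc] := ex z Dz.
pose e x := `|depth v (f x t0) - 2^-1|.
have ce : contR z e.
  suff ch : contR z (fun x => depth v (f x t0) - 2^-1).
    by apply: (contR_comp ch (u := fun r : R => `|r|)); exact: norm_continuous.
  apply: contRB; last exact: contR_cst.
  apply: contR_sum => j _; apply: contRB; first exact: contR_cst.
  by apply: (contR_slice (F := fun z t => f z t 0 j)); exact: cf.
have e0 : e z = 0 by rewrite /e ht0 subrr normr0.
have cfi : contR z (fun x => f x t0 0 i).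
  by apply: (contR_slice (F := fun z t => f z t 0 i)); exact: cf.
rewrite /contR /prop_for /continuous_at hc.
apply: (@squeeze_cvgr _ _ _ _ (fun x => f x t0 0 i - e x) (fun x => f x t0 0 i + e x)).
- have : \forall x \near z, D x by exact: open_nbhs_nbhs.
  apply: filterS => x Dx; have [t ht ->] := ex x Dx.
  have := dipath_dist t t0 i (df _ Dx).
  by rewrite ht [leRHS]distrC -/(e x) ler_norml; lra.
- by have := contRB cfi ce; rewrite /contR /prop_for /continuous_at e0 subr0.
- by have := contRD cfi ce; rewrite /contR /prop_for /continuous_at e0 addr0.
Qed.

End Crossings.

(** * Contractibility as an extension property *)

Lemma cvg_row {R : realType} {n : nat} {T : Type} (F : set_system T)
    (h : T -> 'rV[R]_n) (x : 'rV[R]_n) : Filter F ->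
  (forall i, (fun t => h t 0 i) @ F --> x 0 i) -> h @ F --> x.
Proof.
move=> FF hx A [P Px PA]; rewrite nbhs_filterE /=.
have : \forall t \near F, forall i, P 0 i (h t 0 i).
  by apply: filter_forall => i; exact: (hx i _ (Px 0 i)).
by apply: filterS => t Pt; apply: PA => i j; rewrite ord1.
Qed.

Lemma cvg_set_val {S T : topologicalType} (A : set T) (h : S -> A) (z : S) :
  (fun x => \val (h x)) @ z --> \val (h z) -> h @ z --> h z.
Proof.
move=> ch U [? [[W oW <-]]] /= Wz /filterS; apply; apply: ch.
exact: open_nbhs_nbhs.
Qed.

(** Apply the contraction to [f] at time [2 * w] clamped to the unit interval. Nothing moves where
    [w <= 0], and the centre is already reached at [w = 1/2], so the result continues as a constant
    past the region where [f] is controlled. *)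
Lemma contractible_extension {R : realType} {n : nat} (L : set 'rV[R]_n) :
  contractible R L ->
  forall (Z : topologicalType) (O : set Z) (w : Z -> R) (f : Z -> 'rV[R]_n),
  open O -> (forall z, O z -> contR z w) ->
  (forall z, O z -> w z < 1 -> L (f z) /\ forall i, contR z (fun x => f x 0 i)) ->
  exists g : Z -> 'rV[R]_n,
    (forall z, O z -> L (g z) /\ forall i, contR z (fun x => g x 0 i)) /\
    forall z, O z -> w z <= 0 -> g z = f z.
Proof.
move=> [c [H [cH H0 H1]]] Z O w f oO cw Lf.
have c01 (r : R) : clamp 1 r \in unit_itv R.
  by rewrite inE /unit_itv /= in_itv /= clamp_itv.
pose s z : unit_itv R := exist _ (clamp 1 (2 * w z)) (c01 (2 * w z)).
(* The default [c] occurs only where [f z] is outside [L], hence never where [O z] and [w z < 1]. *)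
pose fL z : L := insubd c (f z).
pose g z : 'rV[R]_n := if w z < 1 then \val (H (fL z, s z)) else \val c.
have fLE z : L (f z) -> \val (fL z) = f z by move=> Lz; rewrite val_insubd mem_set.
exists g; split=> [z Oz|z Oz wz]; last first.
  have wz1 : w z < 1 by lra.
  have sz : s z = I0 R by apply/val_inj; rewrite /= clamp_low //; lra.
  by rewrite /g wz1 sz H0 fLE //; case: (Lf z Oz wz1).
split=> [|i]; first by rewrite /g; case: ifP => _; exact: set_valP.
have [wz|wz] := ltP (w z) 1.
  have near1 : \forall x \near z, O x /\ w x < 1.
    apply: filterI; first exact: open_nbhs_nbhs.
    by apply: near_lt => //; [exact: cw|exact: contR_cst].
  apply: (@contR_near _ _ _ _ (fun x => (\val (H (fL x, s x)) : 'rV[R]_n) 0 i)).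
    by apply: filterS near1 => x [_ wx]; rewrite /g wx.
  apply: (contR_comp (h := fun x => \val (H (fL x, s x)) : 'rV[R]_n)
    (u := fun y => y 0 i)); last exact: coord_continuous.
  apply: (@continuous_comp _ _ _ (fun x => H (fL x, s x)) (\val : L -> 'rV[R]_n));
    last exact: initial_continuous.
  apply: (@continuous_comp _ _ _ (fun x => (fL x, s x)) H); last exact: cH.
  apply: (@cvg_pair _ _ _ (nbhs z) (nbhs (fL z)) (nbhs (s z))).
    apply: cvg_set_val; rewrite fLE; last by case: (Lf z Oz wz).
    apply: (@cvg_trans _ (f @ z)).
      apply: near_eq_cvg; apply: filterS near1 => x [Ox wx].
      by rewrite fLE //; case: (Lf x Ox wx).
    by apply: cvg_row => j; case: (Lf z Oz wz) => _; apply.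
  suff cs : contR z (fun x => clamp 1 (2 * w x)) by apply: cvg_set_val; exact: cs.
  apply: contR_clamp; first exact: contR_cst.
  by apply: contRM; [exact: contR_cst|exact: cw].
apply: (@contR_near _ _ _ _ (fun=> (\val c : 'rV[R]_n) 0 i)); last exact: contR_cst.
have : \forall x \near z, 2^-1 < w x.
  by apply: near_lt; [exact: contR_cst|exact: cw|lra].
apply: filterS => x wx; rewrite /g; case: ifP => // _.
suff -> : s x = I1 R by rewrite H1.
by apply/val_inj; rewrite /= clamp_high //; lra.
Qed.

(** * Extension of families of dipaths *)

Section Extension.
Context {R : realType} {n : nat}.
Variable K : set 'rV[R]_n.
Implicit Types (u v : 'rV[int]_n).

(* Equivalent to contractibility, but it can be glued along open covers. *)
Definition extensible v :=
  forall (Z : topologicalType) (O : set Z) (w : Z -> R) (f : Z -> R -> 'rV[R]_n),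
  open O -> (forall z, O z -> contR z w) ->
  dipath_family K v (O `&` [set z | w z < 1]) f ->
  exists g, dipath_family K v O g /\ forall z, O z -> w z <= 0 -> g z = f z.

(* Where M is large g is pushed towards the dipaths through u, for a time
   governed by lam; once the push is complete the dipath is an extension of a
   dipath ending at u, and such a family extends to the whole of {0 < lam}.
   The threshold grows from a to b to leave room for the cut-off. *)
Lemma stage u v (Z : topologicalType) (O : set Z) (M lam : Z -> R) (a b : R)
    (g : Z -> R -> 'rV[R]_n) :
  (forall i, 0 <= u 0 i <= v 0 i) -> box (embZ R u) (embZ R v) `<=` K ->
  extensible u -> open O -> a < b ->
  (forall z, O z -> contR z M) -> (forall z, O z -> contR z lam) ->
  (forall z, O z -> 0 <= lam z) ->
  dipath_family K v (O `&` [set z | a < M z]) g ->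
  (forall z t, O z -> a < M z -> 0 < lam z -> good K u (g z t)) ->
  exists g', [/\ dipath_family K v (O `&` [set z | b < M z + lam z]) g',
    forall z, O z -> b < M z -> lam z = 0 -> g' z = g z &
    forall z t, O z -> b < M z + lam z -> 0 < lam z -> good K u (g' z t)].
Proof.
move=> uv uvK ext oO ab cM clam lam0 gfam ggood.
(* Since [m + c = b], a point with [b < M + lam] and [M <= m] satisfies [c < lam]. *)
pose m := (a + b) / 2; pose c := (b - a) / 2.
have am : a < m by rewrite /m; lra.
have c0 : 0 < c by rewrite /c; lra.
have mcb : m + c = b by rewrite /m /c; lra.
have near_O z : O z -> \forall x \near z, O x by move=> Oz; exact: open_nbhs_nbhs.
(* Rescaling of [M]: the truncated family is given where [a < M] and has to be preserved where
   [m <= M]. *)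
pose w' z := (m - M z) / (m - a).
have w'lt z : (w' z < 1) = (a < M z).
  by rewrite /w' ltr_pdivrMr ?subr_gt0 // mul1r; lra.
have w'le z : (w' z <= 0) = (m <= M z).
  by rewrite /w' pmulr_lle0 ?subr_le0 // invr_gt0 subr_gt0.
have [gd gc] := gfam.
have [|z [Oz _]||beta [[bd bc] bE]] := ext Z (O `&` [set z | 0 < lam z]) w'
  (fun z t => cap u (g z t)).
- rewrite openE => z [Oz lz]; apply: filterI; first exact: near_O.
  by apply: near_lt => //; [exact: contR_cst|exact: clam].
- apply: contRM; last exact: contR_cst.
  by apply: contRB; [exact: contR_cst|exact: cM].
- apply: (cap_family uv) => [|z t [[Oz lz]] /=]; last by rewrite w'lt => *; exact: ggood.
  by split=> [z|z t i] [[Oz _] /=]; rewrite w'lt => *; [apply: gd|apply: gc].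
(* The push is complete as soon as [lam] reaches [c]. *)
pose tau z := clamp 1 (lam z / c).
pose g' z := if m < M z then deform u v (tau z) (g z) else extend u v (beta z).
have tau01 z : 0 <= tau z <= 1 by exact: clamp_itv.
have tau_c z : c < lam z -> tau z = 1.
  by move=> lc; apply: clamp_high => //; rewrite ler_pdivlMr // mul1r ltW.
(* The two branches of [g'] agree here: a complete push is the extension of the truncated path,
   which is [beta] where [m <= M]. This makes the gluing continuous across [M = m]. *)
have gE z : O z -> c < lam z -> g' z = extend u v (beta z).
  move=> Oz lc; rewrite /g'; case: ifP => // mM; rewrite tau_c // deform1 bE //.
    by split=> //=; exact: lt_trans lc.
  by rewrite w'le ltW.
exists g'; split; first split.
- move=> z [Oz /= bz]; rewrite /g'; case: (ltP m (M z)) => Mz; last first.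
    have lz : 0 < lam z by lra.
    by case: (dipath_extend uv uvK (bd z (conj Oz lz))).
  have dz : dipath K v (g z) by apply: gd; split=> //=; exact: lt_trans Mz.
  have [lz|lz] := ltP 0 (lam z).
    have gz t : good K u (g z t) by apply: ggood => //; exact: lt_trans Mz.
    by case: (dipath_deform uv uvK (tau01 z) gz dz).
  have -> : tau z = 0.
    by apply: clamp_low => //; rewrite pmulr_lle0 // invr_gt0.
  by rewrite deform0.
- move=> z t i [Oz /= bz].
  have [Mz|Mz] := ltP m (M z).
    apply: (@contR_near _ _ _ _ (fun p => deform u v (tau p.1) (g p.1) p.2 0 i)).
      have : \forall p \near (z, t), m < M p.1.
        apply: near_lt => //; first exact: contR_cst.
        by apply: contR_fst; exact: cM.
      by apply: filterS => p mp; rewrite /g' mp.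
    apply: contR_deform => [|s j].
      apply: contR_clamp; first exact: contR_cst.
      by apply: contRM; [exact: clam|exact: contR_cst].
    by apply: gc; split=> //=; exact: lt_trans Mz.
  have lz : c < lam z by lra.
  apply: (@contR_near _ _ _ _ (fun p => extend u v (beta p.1) p.2 0 i)).
    have : \forall p \near (z, t), c < lam p.1.
      apply: near_lt => //; first exact: contR_cst.
      by apply: contR_fst; exact: clam.
    have : \forall p \near (z, t), O p.1.
      by apply: (@cvg_fst _ _ (nbhs z) (nbhs t)); exact: near_O.
    by apply: filterS2 => p Op lp; rewrite gE.
  by apply: contR_extend => s j; apply: bc; split=> //=; exact: lt_trans lz.
- move=> z Oz bz lz; rewrite /g' ifT; last by lra.
  by rewrite /tau lz mul0r clamp_low ?deform0.
- move=> z t Oz bz lz; rewrite /g'; case: (ltP m (M z)) => Mz.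
    have aM : a < M z by exact: lt_trans Mz.
    have gz s : good K u (g z s) by apply: ggood.
    have dz : dipath K v (g z) by apply: gd.
    by case: (dipath_deform uv uvK (tau01 z) gz dz).
  by case: (dipath_extend uv uvK (bd z (conj Oz lz))).
Qed.

(** One [stage] per simplex, by decreasing size, with [M] accumulating the weights until [M >= 1]
    everywhere. The order preserves goodness: a later simplex of positive weight is comparable to
    the current [S] and no larger, hence contained in it, so goodness for [v - S] implies goodness
    for the higher vertex. *)
Lemma stages v (Z : topologicalType) (O : set Z) (lam : {set 'I_n} -> Z -> R)
    (s : seq {set 'I_n}) (a : R) (M : Z -> R) (g : Z -> R -> 'rV[R]_n) :
  open O ->
  (forall S z, O z -> contR z (lam S)) ->
  (forall S z, O z -> 0 <= lam S z) ->
  (forall S S' z, O z -> 0 < lam S z -> 0 < lam S' z ->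
     S \subset S' \/ S' \subset S) ->
  sorted (fun S S' : {set 'I_n} => (#|S'| <= #|S|)%N) s ->
  (forall S, S \in s -> [/\ forall i, 0 <= lower v S 0 i <= v 0 i,
     box (embZ R (lower v S)) (embZ R v) `<=` K & extensible (lower v S)]) ->
  a < 1 -> (forall z, O z -> contR z M) ->
  (forall z, O z -> 1 <= M z + \sum_(S <- s) lam S z) ->
  dipath_family K v (O `&` [set z | a < M z]) g ->
  (forall S z t, S \in s -> O z -> a < M z -> 0 < lam S z ->
     good K (lower v S) (g z t)) ->
  exists g', dipath_family K v O g' /\
    forall z, O z -> (forall S, lam S z = 0) -> g' z = g z.
Proof.
move=> oO clam lam0 chain.
elim: s a M g => [|S s IHs] a M g srt sP a1 cM Msum gfam ggood.
  exists g; split=> //; have Oa z : O z -> a < M z.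
    by move=> /Msum; rewrite big_nil addr0; exact: lt_le_trans.
  by case: gfam => gd gc; split=> [z|z t i] Oz; [apply: gd|apply: gc]; split=> //=;
    exact: Oa.
have [uv uvK ext] := sP S (mem_head _ _).
(* Halving the distance to 1 keeps every threshold below 1, however many stages follow. *)
pose b := (a + 1) / 2.
have ab : a < b by rewrite /b; lra.
have b1 : b < 1 by rewrite /b; lra.
have gS z t : O z -> a < M z -> 0 < lam S z -> good K (lower v S) (g z t).
  by move=> *; apply: ggood => //; exact: mem_head.
have [g' [g'fam g'E g'good]] :=
  stage uv uvK ext oO ab cM (clam S) (lam0 S) gfam gS.
have [||||||g'' [g''fam g''E]] := IHs b (fun z => M z + lam S z) g' _ _ b1.
- exact: path_sorted srt.
- by move=> S' S's; apply: sP; rewrite in_cons S's orbT.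
- by move=> z Oz; apply: contRD; [exact: cM|exact: clam].
- by move=> z Oz; have := Msum z Oz; rewrite big_cons addrA.
- exact: g'fam.
- move=> S' z t S's Oz bz lz.
  have S'S : (#|S'| <= #|S|)%N.
    have /allP : all (fun S' : {set 'I_n} => (#|S'| <= #|S|)%N) s.
      by apply: (order_path_min _ srt) => A B C /= AB BC; exact: leq_trans AB.
    exact.
  have [lS|lS] := ltP 0 (lam S z).
    apply: good_le (g'good z t Oz bz lS) => i; apply: lower_sub.
    have [SS'|//] := chain S S' z Oz lS lz.
    suff -> : S = S' by [].
    by apply/eqP; rewrite eqEcard SS'.
  have {}lS : lam S z = 0 by apply/eqP; rewrite eq_le lS lam0.
  have bM : b < M z by move: bz; rewrite lS addr0.
  rewrite g'E //; apply: ggood => //; first by rewrite in_cons S's orbT.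
  exact: lt_trans bM.
exists g''; split=> // z Oz l0; rewrite g''E // g'E //.
have := Msum z Oz; rewrite big1 ?addr0 => [|S' _]; last exact: l0.
exact: lt_le_trans.
Qed.

(* A partition of unity (up to normalisation) subordinate to the barycentric
   subdivision: the S of positive weight at t are superlevel sets of t, hence
   form a flag of faces of the carrier of t. *)
Definition flag_weight (S : {set 'I_n}) (t : 'rV[R]_n) : R :=
  \prod_(i in S) (Num.max 0 (t 0 i) *
                  \prod_(j in ~: S) Num.max 0 (t 0 i - t 0 j)).

Implicit Types (S : {set 'I_n}) (t : 'rV[R]_n).

Lemma flag_weight_ge0 S t : 0 <= flag_weight S t.
Proof.
apply: prodr_ge0 => i _; rewrite mulr_ge0 ?le_max ?lexx //.
by apply: prodr_ge0 => j _; rewrite le_max lexx.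
Qed.

Lemma flag_weight_gt0 S t : (forall i, i \in S -> 0 < t 0 i) ->
  (forall i j, i \in S -> j \notin S -> t 0 j < t 0 i) -> 0 < flag_weight S t.
Proof.
move=> tS tSS; apply: prodr_gt0 => i iS; rewrite mulr_gt0 ?lt_max ?tS ?orbT //.
apply: prodr_gt0 => j; rewrite finset.in_setC lt_max => jS.
by rewrite subr_gt0 tSS ?orbT.
Qed.

Lemma flag_weight_gt0E S t : 0 < flag_weight S t ->
  (forall i, i \in S -> 0 < t 0 i) /\
  (forall i j, i \in S -> j \notin S -> t 0 j < t 0 i).
Proof.
move=> /lt0r_neq0; rewrite /flag_weight => /prodf_neq0 w0.
have pos (x : R) : Num.max 0 x != 0 -> 0 < x.
  by case: leP => // x0; rewrite eqxx.
split=> [i iS|i j iS jS].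
  by have := w0 i iS; rewrite mulf_eq0 negb_or => /andP[/pos].
have := w0 i iS; rewrite mulf_eq0 negb_or => /andP[_ /prodf_neq0 /(_ j)].
by rewrite finset.in_setC => /(_ jS)/pos; rewrite subr_gt0.
Qed.

Lemma flag_weight_chain S S' t : 0 < flag_weight S t -> 0 < flag_weight S' t ->
  S \subset S' \/ S' \subset S.
Proof.
move=> /flag_weight_gt0E[_ wS] /flag_weight_gt0E[_ wS'].
case: (boolP (S \subset S')) => [|/fintype.subsetPn[i iS iS']]; [by left|right].
apply/fintype.subsetP => j jS'; apply/negPn/negP => jS.
by have := wS i j iS jS; rewrite ltNge => /negP; apply; rewrite ltW // wS'.
Qed.

Lemma flag_weight_contR S {Z : topologicalType} (h : Z -> 'rV[R]_n) z :
  (forall i, contR z (fun x => h x 0 i)) ->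
  contR z (fun x => flag_weight S (h x)).
Proof.
move=> ch; apply: contR_prod => i _; apply: contRM.
  by apply: contR_max => //; exact: contR_cst.
apply: contR_prod => j _; apply: contR_max; first exact: contR_cst.
by apply: contRB.
Qed.

(** Makes the total weight positive, so that it can be normalised. The set where [t] attains its
    maximum is a superlevel set, and the maximum is positive because the coordinates sum to 1. *)
Lemma flag_weight_argmax t : (forall i, 0 <= t 0 i) -> \sum_i t 0 i = 1 ->
  exists S : {set 'I_n}, [/\ S != finset.set0, S \subset carrier t & 0 < flag_weight S t].
Proof.
move=> t0 t1.
have [i0 ti0] : exists i, 0 < t 0 i.
  apply/existsP; apply: contraT => /existsPn h.
  move/eqP: t1; rewrite big1 ?(eq_sym 0) ?oner_eq0 // => i _.
  by apply/eqP; rewrite eq_le t0 andbT leNgt h.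
pose i1 := [arg max_(i > i0) t 0 i]%O.
have i1P j : t 0 j <= t 0 i1.
  by rewrite /i1; case: Order.TotalTheory.arg_maxP => // i _; exact.
have ti1 : 0 < t 0 i1 by exact: lt_le_trans (i1P i0).
pose S := finset.finset (fun i => t 0 i == t 0 i1).
have SE i : (i \in S) = (t 0 i == t 0 i1) by rewrite finset.inE.
exists S; split.
- by apply/finset.set0Pn; exists i1; rewrite SE.
- by apply/fintype.subsetP => i; rewrite SE finset.inE => /eqP ->; exact: lt0r_neq0.
apply: flag_weight_gt0 => [i|i j]; rewrite !SE => /eqP -> // ij.
by rewrite lt_neqAle ij i1P.
Qed.

End Extension.

(** * The inductive step at a vertex *)

Section Step.
Context {R : realType} {n : nat}.
Variable K : set 'rV[R]_n.
Hypothesis K_cubical : cubical_complex K.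
Hypothesis K_min : minimal_vertex K 0.
Implicit Types (v : 'rV[int]_n) (S : {set 'I_n}).

(** A dipath from 0 to 0 is squeezed between equal bounds, hence constant. *)
Lemma extensible0 : extensible K 0.
Proof.
move=> Z O w f oO cw [fd _]; have emb0 : embZ R (0 : 'rV[int]_n) = 0 by rewrite /embZ map_mx0.
have K0 : K 0 by case: K_min => + _; rewrite /vertices /= emb0.
exists (fun _ _ => 0); split; first split.
- by move=> z _; split.
- by move=> z t i _; exact: contR_cst.
move=> z Oz wz; apply/funext => t; apply/rowP => i; rewrite mxE.
have wz1 : w z < 1 by lra.
have := dipath_itv t i (fd z (conj Oz wz1)).
by rewrite mxE => h; apply/esym/eqP; rewrite eq_le andbC.
Qed.

(** The crossing points map the parameters with [w < 1] to the realization of the past link, and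
    contractibility extends this map to [phi] on all of [O]. The weights at [phi z] then tell
    [stages] through which vertices [v - S] to route the dipaths. *)
Lemma extensible_step v : vertices K v -> v != 0 ->
  contractible R (realization R (past_link K 0 v)) ->
  (forall S, past_link K 0 v S -> S != finset.set0 -> extensible K (lower v S)) ->
  extensible K v.
Proof.
move=> Kv v0 Lc ext Z O w f oO cw ffam.
have v_ge0 i : 0 <= v 0 i by exact: (vertex_ge0 K_min).
pose D := O `&` [set z | w z < 1].
have oD : open D.
  rewrite openE => z [Oz wz]; apply: filterI; first exact: open_nbhs_nbhs.
  by apply: near_lt => //; [exact: cw|exact: contR_cst].
have ex z : D z -> exists2 t, depth v (f z t) = 2^-1 & crossing v (f z) = f z t.
  move=> Dz; apply/crossingP; have [fd fc] := ffam.
  apply: (crossing_exists (fd _ Dz)) => // i t.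
  by apply: (contR_path (F := fun z t => f z t 0 i)); exact: fc.
(* The function [2 * w - 1] is below 1 exactly where [w < 1], and nonpositive exactly where
   [w <= 1/2]: there [phi] remains the true crossing point. *)
have [|z Oz wz|phi [phiL phiE]] := contractible_extension Lc
    (w := fun z => 2 * w z - 1) (f := fun z => bary v (crossing v (f z))) oO.
- move=> z Oz; apply: contRB; last exact: contR_cst.
  by apply: contRM; [exact: contR_cst|exact: cw].
- have Dz : D z by split=> //=; lra.
  split=> [|i].
    have [t ht ->] := ex z Dz; have [fd _] := ffam.
    exact: crossing_realization (fd _ Dz) ht.
  apply: contR_ext => [x|]; first exact: mxE.
  apply: contRM; first exact: contR_cst.
  apply: contRB; first exact: contR_cst.
  exact: (@crossing_contR _ _ K _ D).
pose s0 := [seq S <- enum {set 'I_n} | (S != finset.set0) && `[< past_link K 0 v S >]].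
pose s := sort (fun S S' : {set 'I_n} => (#|S'| <= #|S|)%N) s0.
have mem_s S : (S \in s) = (S != finset.set0) && `[< past_link K 0 v S >].
  by rewrite mem_sort mem_filter mem_enum andbT.
pose tot z := \sum_(S <- s) flag_weight S (phi z).
have tot_gt0 z : O z -> 0 < tot z.
  move=> Oz; have [[phi0 phi1 phiC] _] := phiL z Oz.
  have [S [Sn0 Ssub Sw]] := flag_weight_argmax phi0 phi1.
  have Ss : S \in s.
    rewrite mem_s Sn0; apply/asboolP.
    exact: (link_sub K_min Ssub phiC).
  rewrite /tot (big_rem S) //= ltr_pwDl //.
  by apply: sumr_ge0 => *; exact: flag_weight_ge0.
(* The weights are switched off where [w <= 0], so that [f] is kept there, and fully on from
   [w = 1/2]. *)
pose rho z := clamp 1 (2 * w z).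
have rho01 z : 0 <= rho z <= 1 by exact: clamp_itv.
pose lam S z := rho z * (flag_weight S (phi z) / tot z).
have crho z : O z -> contR z rho.
  move=> Oz; apply: contR_clamp; first exact: contR_cst.
  by apply: contRM; [exact: contR_cst|exact: cw].
have cphi S z : O z -> contR z (fun x => flag_weight S (phi x)).
  by move=> Oz; apply: flag_weight_contR; case: (phiL z Oz).
have clam S z : O z -> contR z (lam S).
  move=> Oz; apply: contRM; first exact: crho.
  apply: contRM; first exact: cphi.
  apply: contRV; first by rewrite gt_eqF // tot_gt0.
  by apply: contR_sum => *; exact: cphi.
have lam0 S z : O z -> 0 <= lam S z.
  move=> Oz; case/andP: (rho01 z) => r0 _.
  by rewrite mulr_ge0 // divr_ge0 ?flag_weight_ge0 ?ltW ?tot_gt0.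
have lam_gt0 S z : O z -> 0 < lam S z -> 0 < flag_weight S (phi z).
  move=> Oz; rewrite !lt0r flag_weight_ge0 andbT mulf_eq0 negb_or.
  by case/andP => /andP[_]; rewrite mulf_eq0 negb_or => /andP[].
have rho_lt1 z : 0 < 1 - rho z -> w z < 2^-1.
  rewrite subr_gt0 ltNge; apply: contraNlt => wz.
  by rewrite /rho clamp_high //; lra.
(* With [M = 1 - rho] the weights and [M] add up to 1. The starting domain [0 < M] lies in
   [w < 1/2], where [phi] is the crossing point, so a positive weight of [S] puts [S] in its carrier
   and [f z] is good for [v - S]. *)
have [||S|z Oz|z Oz||S z t|g [gfam gE]] := @stages _ _ K v Z O lam s 0
    (fun z => 1 - rho z) f oO clam lam0 _ _ _ ltr01.
- move=> S S' z Oz /(lam_gt0 _ _ Oz) h /(lam_gt0 _ _ Oz); exact: flag_weight_chain h.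
- by apply: sort_sorted => S S' /=; case: (leqP #|S'| #|S|) => // /ltnW.
- rewrite mem_s => /andP[S0 /asboolP LS]; split; first exact: (link_lower K_min).
    exact: link_box.
  exact: ext.
- by apply: contRB; [exact: contR_cst|exact: crho].
- by rewrite -mulr_sumr -mulr_suml divff ?gt_eqF ?tot_gt0 // mulr1 subrK.
- have [fd fc] := ffam.
  by split=> [z|z t i] [Oz /= /rho_lt1 wz]; [apply: fd|apply: fc]; split=> //=; lra.
- rewrite mem_s => /andP[S0 /asboolP LS] Oz /rho_lt1 wz /(lam_gt0 _ _ Oz).
  have Dz : D z by split=> //=; lra.
  have [t0 ht0 hc] := ex z Dz; have [fd _] := ffam.
  rewrite phiE //; last lra.
  move=> /flag_weight_gt0E[wS _]; rewrite hc in wS.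
  apply: (crossing_good K_cubical K_min (fd z Dz) ht0).
  by apply/fintype.subsetP => i /wS wi; rewrite finset.inE gt_eqF.
exists g; split=> // z Oz wz; apply: gE => // S.
by rewrite /lam /rho clamp_low ?mul0r //; lra.
Qed.
End Step.

(** * Reachable vertices *)

Section Reachability.
Context {R : realType} {n : nat}.
Variable K : set 'rV[R]_n.
Hypothesis K_cubical : cubical_complex K.
Hypothesis K_min : minimal_vertex K 0.
Implicit Types (v : 'rV[int]_n) (S T : {set 'I_n}).

Definition reachable v :=
  exists a, dipath K v a /\ forall i t, contR t (fun t => a t 0 i).

(** For [w] constantly 1 the prescribed part is empty, so the extension property creates a dipath
    from no data. *)
Lemma extensible_reachable v : extensible K v -> reachable v.
Proof.
move=> ext.
have [||g [[gd gc] _]] := ext R setT (fun=> 1) (fun _ _ => 0) openT.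
- by move=> z _; exact: contR_cst.
- by split=> [z|z t i] [_ /=]; rewrite ltxx.
exists (g 0); split; first exact: gd.
by move=> i t; apply: (contR_path (F := fun z t => g z t 0 i)); exact: gc.
Qed.

Lemma reachable_extend v S :
  past_link K 0 v S -> reachable (lower v S) -> reachable v.
Proof.
move=> LS [b [db cb]].
exists (extend (lower v S) v b); split.
  by case: (dipath_extend (link_lower K_min LS) (link_box LS) db).
move=> i t.
apply: (contR_path (z := 0 : R) (F := fun _ t => extend (lower v S) v b t 0 i)).
apply: (@contR_extend _ _ _ _ _ (fun=> b)) => s j.
by apply: (@contR_comp _ _ _ snd (fun t => b t 0 j)); [exact: cvg_snd|exact: cb].
Qed.

(** [S] is the carrier of a crossing point, nonempty because its depth is not 0. Truncating the
    dipath below [v - T] reaches [v - T] for each face [T]. *)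
Lemma reachable_crossing v : reachable v -> vertices K v -> v != 0 ->
  exists S, [/\ S != finset.set0, past_link K 0 v S,
    forall T, T \subset S -> reachable (lower v T) &
    exists t, realization R (past_link K 0 v) t].
Proof.
move=> [a [da ca]] Kv v0.
have v_ge0 i : 0 <= v 0 i by exact: (vertex_ge0 K_min).
have [t ht] := crossing_exists da v0 v_ge0 ca.
have LS := crossing_link K_cubical K_min da ht.
exists (carrier (bary v (a t))); split=> //.
- apply: contra_eqN ht => /eqP S0; rewrite /depth big1 ?(eq_sym 0) ?invr_eq0 ?pnatr_eq0 //.
  move=> i _; apply/eqP; rewrite subr_eq0 eq_sym; apply/negPn.
  by rewrite -mem_carrier_bary S0 finset.inE.
- move=> T TS; exists (fun t => cap (lower v T) (a t)); split.
    apply: (cap_dipath _ _ da) => [|s]; last exact: (crossing_good K_cubical K_min da ht).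
    exact: (link_lower K_min (link_sub K_min TS LS)).
  move=> i s; apply: contR_ext => [x|]; first exact: mxE.
  by apply: contR_min; [exact: ca|exact: contR_cst].
- by eexists; exact: (crossing_realization K_cubical K_min da ht).
Qed.

Lemma lower_lower v S T : [disjoint S & T]%bool ->
  lower (lower v S) T = lower v (S :|: T)%SET.
Proof.
move=> dST; apply/rowP => i; rewrite !lowerE finset.in_setU.
case: (boolP (i \in S)) => [/(disjointFr dST) ->|_] /=; first by rewrite subr0.
by rewrite subr0.
Qed.

Lemma link_lower_lower v S T : [disjoint S & T]%bool ->
  past_link K 0 v (S :|: T)%SET -> past_link K 0 (lower v S) T.
Proof.
move=> dST LST; apply: (box_link K_min) => x; rewrite lower_lower // => xb.
apply: (link_box LST) => i; have := xb i.
rewrite ![embZ _ _ _ _]mxE => /andP[-> h]; rewrite (le_trans h) //.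
by rewrite ler_int lower_le.
Qed.

(* On the realization the total weight of the vertices satisfying P is
   0 or 1. *)
Lemma link_connected (L : set {set 'I_n}) (P : pred 'I_n) i j :
  contractible R (realization R L) ->
  (forall S T, T \subset S -> L S -> L T) ->
  (forall k l, L [set k; l]%SET -> P k -> P l) ->
  L [set i]%SET -> L [set j]%SET -> P i -> P j.
Proof.
move=> Lc Lsub LP Li Lj Pi; apply: contraT => nPj.
pose e k : 'rV[R]_n := delta_mx 0 k.
have eL k : L [set k]%SET -> realization R L (e k).
  move=> Lk; split=> [l||].
  - by rewrite mxE /= ler0n.
  - rewrite (bigD1 k) //= big1 => [|l lk]; rewrite mxE ?eqxx ?addr0 //=.
    by rewrite (negbTE lk).
  - suff -> : [set l | e k 0 l != 0]%SET = [set k]%SET by [].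
    by apply/setP => l; rewrite !finset.inE mxE /=; case: (l == k); rewrite ?oner_eq0 ?eqxx.
(* The jump of [f] is at [r = 1/2], the only point where [1 - |4r - 2|] is not below 1; at [r = 0]
   and [r = 1] this function is negative. The extension is thus a path in the realization from [e i]
   to [e j]. *)
pose f (r : R) := if r < 2^-1 then e i else e j.
have [|z _ wz|g [gL gE]] := contractible_extension Lc (w := fun r : R => 1 - `|4 * r - 2|)
    (f := f) (openT : open [set: R]).
- move=> z _; apply: contRB; first exact: contR_cst.
  suff ch : contR z (fun r => 4 * r - 2).
    by apply: (contR_comp ch (u := fun r : R => `|r|)); exact: norm_continuous.
  apply: contRB; last exact: contR_cst.
  by apply: contRM; [exact: contR_cst|exact: cvg_id].
- split=> [|k]; first by rewrite /f; case: ifP => _; exact: eL.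
  have [z2|z2] := ltP z 2^-1.
    apply: (@contR_near _ _ _ _ (fun=> e i 0 k)); last exact: contR_cst.
    have : \forall x \near z, x < 2^-1.
      by apply: (near_lt (u := id) (v := fun=> 2^-1)); [exact: cvg_id|exact: contR_cst|].
    by apply: filterS => x; rewrite /f => ->.
  apply: (@contR_near _ _ _ _ (fun=> e j 0 k)); last exact: contR_cst.
  have {}z2 : 2^-1 < z.
    rewrite lt_neqAle z2 andbT; apply: contraTneq wz => <-.
    by rewrite -leNgt (_ : 4 / 2 - 2 = 0) ?normr0 ?subr0 //; lra.
  have : \forall x \near z, 2^-1 < x.
    by apply: (near_lt (u := fun=> 2^-1) (v := id)); [exact: contR_cst|exact: cvg_id|].
  by apply: filterS => x /ltW; rewrite leNgt /f => /negbTE ->.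
have w01 : (1 - `|4 * 0 - 2| <= 0 :> R) /\ (1 - `|4 * 1 - 2| <= 0 :> R).
  by rewrite !subr_le0 !ler_normr; split; apply/orP; [right|left]; lra.
have [g0 g1] : g 0 = e i /\ g 1 = e j.
  rewrite !gE //; try by case: w01.
  by rewrite /f ifT ?ifF //; [apply/negbTE; rewrite -leNgt|]; lra.
pose chi r := \sum_(k | P k) g r 0 k.
have cchi : continuous chi.
  by move=> r; apply: contR_sum => k _; case: (gL r I).
have chi0 : chi 0 = 1.
  rewrite /chi g0 (bigD1 i) //= big1 => [|k /andP[_ ki]]; rewrite mxE ?eqxx ?addr0 //=.
  by rewrite (negbTE ki).
have chi1 : chi 1 = 0.
  rewrite /chi g1 big1 // => k Pk; rewrite mxE /=.
  by case: eqP => // kj; rewrite -kj Pk in nPj.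
have [||r _ hr] := @IVT R chi 0 1 2^-1 ler01.
- exact: continuous_subspaceT.
- by rewrite chi0 chi1 ge_min le_max; apply/andP; split; apply/orP; [right|left]; lra.
have [[t0 t1 tL] _] := gL r I.
(* Any two vertices of the carrier span an edge, so a carrier that meets [P] lies in [P]. The weight
   [chi r] is then 1, and otherwise 0, whereas it equals 1/2. *)
case: (pickP (fun k => P k && (g r 0 k != 0))) => [k /andP[Pk gk]|none].
  have : chi r = 1.
    rewrite -t1 [RHS](bigID P) /= [X in _ + X]big1 ?addr0 // => l nPl.
    apply/eqP; apply: contraNT nPl => gl; apply: LP Pk; apply: Lsub tL.
    by apply/fintype.subsetP => m; rewrite !finset.inE => /orP[]/eqP ->.
  rewrite hr; lra.
have : chi r = 0.
  by rewrite /chi big1 // => k Pk; have := none k; rewrite Pk /= => /negbFE/eqP.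
rewrite hr; lra.
Qed.

Hypothesis past_links : forall k : 'rV[int]_n, vertices K k ->
  contractible R (realization R (past_link K 0 k)) \/
  empty_space (realization R (past_link K 0 k)).

Lemma past_link_contractible v : reachable v -> vertices K v -> v != 0 ->
  contractible R (realization R (past_link K 0 v)).
Proof.
move=> rv Kv v0; have [S [_ _ _ [t Lt]]] := reachable_crossing rv Kv v0.
have [//|] := past_links Kv; move=> /(_ (exist _ t (mem_set Lt))) [].
Qed.

Definition height v : nat := absz (\sum_i v 0 i).

Lemma height_lower v S : past_link K 0 v S -> S != finset.set0 ->
  (height (lower v S) < height v)%N.
Proof.
move=> LS /finset.set0Pn[i iS].
have l0 j : 0 <= lower v S 0 j by case/andP: (link_lower K_min LS j).
have lv j : lower v S 0 j <= v 0 j by exact: lower_le.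
have lt : \sum_j lower v S 0 j < \sum_j v 0 j.
  rewrite (bigD1 i) //= [ltRHS](bigD1 i) //=.
  by rewrite ltr_leD // ?lowerE ?iS ?ltrBlDr ?ltrDl // ler_sum.
have p0 : 0 <= \sum_j lower v S 0 j by apply: sumr_ge0.
rewrite /height -ltz_nat !gez0_abs //; exact: le_trans (ltW lt).
Qed.

Lemma lower_set0 v : lower v finset.set0 = v.
Proof. by apply/rowP => i; rewrite lowerE finset.inE subr0. Qed.

Lemma lower_neq0 v S : past_link K 0 v S -> S != finset.set0 -> v != 0.
Proof.
move=> LS S0; apply: contraTneq (height_lower LS S0) => ->.
by rewrite -leqNgt /height big1 // => i _; rewrite mxE.
Qed.

(** By induction on height. A crossing makes [v - i] reachable for some [i], and reachability
    spreads along edges of the link: from [v - k] descend to [v - k - l] by induction, then climb to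
    [v - l]. As the link is connected, [v - j] is reachable for some [j] in [S], and induction
    descends from there to [v - S]. *)
Lemma reachable_lower v S : reachable v -> vertices K v -> past_link K 0 v S ->
  reachable (lower v S).
Proof.
have [m] := ubnP (height v); elim: m => // m IHm in v S *.
rewrite ltnS => hv rv Kv LS.
have [->|S0] := eqVneq S finset.set0; first by rewrite lower_set0.
have v0 := lower_neq0 LS S0.
have Lsub T T' : T' \subset T -> past_link K 0 v T -> past_link K 0 v T'.
  exact: link_sub.
have n0 k : [set k]%SET != finset.set0 by apply/finset.set0Pn; exists k; rewrite finset.inE.
(* The vertex [v - k] is strictly lower than [v], and the rest of [T] is a simplex of its past
   link. *)
have step k T : k \in T -> past_link K 0 v T -> reachable (lower v [set k]%SET) ->
    reachable (lower v T).
  move=> kT LT rk.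
  have E : ([set k] :|: (T :\ k))%SET = T by exact: finset.setD1K.
  have d : [disjoint [set k]%SET & (T :\ k)%SET]%bool.
    by rewrite disjoints1; apply/negP => /finset.setD1P[]; rewrite eqxx.
  have Lk : past_link K 0 v [set k]%SET by apply: Lsub LT; rewrite finset.sub1set.
  rewrite -E -lower_lower //; apply: IHm => //.
  - exact: leq_trans (height_lower Lk _) hv.
  - exact: link_vertex.
  - by apply: link_lower_lower; rewrite ?E.
have [S1 [S10 LS1 rS1 _]] := reachable_crossing rv Kv v0.
have [i iS1] := finset.set0Pn _ S10.
have ri : reachable (lower v [set i]%SET) by apply: rS1; rewrite finset.sub1set.
have Li : past_link K 0 v [set i]%SET by apply: Lsub LS1; rewrite finset.sub1set.
have [j jS] := finset.set0Pn _ S0.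
have Lj : past_link K 0 v [set j]%SET by apply: Lsub LS; rewrite finset.sub1set.
apply: (step j S jS LS); apply/asboolP.
apply: (link_connected (P := fun k => `[< reachable (lower v [set k]%SET) >])
  (past_link_contractible rv Kv v0) Lsub _ Li Lj); last exact/asboolP.
move=> k l Lkl /asboolP rk; apply/asboolP.
have [<-//|kl] := eqVneq k l.
have rkl : reachable (lower v [set k; l]%SET).
  by apply: (step k) => //; rewrite !finset.inE eqxx.
have d : [disjoint [set l]%SET & [set k]%SET]%bool 
  by rewrite disjoints1 finset.in_set1 eq_sym.
apply: (@reachable_extend _ [set k]%SET).
  by apply: link_lower_lower => //; rewrite finset.setUC.
by rewrite lower_lower // finset.setUC.
Qed.

Lemma reachable_extensible v : reachable v -> vertices K v -> extensible K v.
Proof.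
have [m] := ubnP (height v); elim: m => // m IHm in v *.
rewrite ltnS => hv rv Kv.
have [->|v0] := eqVneq v 0; first exact: extensible0.
apply: extensible_step => //; first exact: past_link_contractible.
move=> S LS S0; apply: IHm.
- exact: leq_trans (height_lower LS S0) hv.
- exact: reachable_lower.
- exact: link_vertex LS.
Qed.

End Reachability.

(** * The compact-open topology *)

Section UnitInterval.
Context {R : realType}.

Lemma clamp_in (r : R) : clamp 1 r \in unit_itv R.
Proof. by rewrite inE /unit_itv /= in_itv /= clamp_itv. Qed.

Definition to_unit (r : R) : unit_itv R := exist _ (clamp 1 r) (clamp_in r).

Lemma to_unitK (s : unit_itv R) : to_unit (\val s) = s.
Proof.
apply/val_inj => /=; apply: clamp_mid.
by have := set_valP s; rewrite /unit_itv /= in_itv.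
Qed.

Lemma to_unit_continuous : continuous to_unit.
Proof.
move=> r; suff cr : contR r (clamp 1) by apply: cvg_set_val; exact: cr.
by apply: contR_clamp; [exact: contR_cst|exact: cvg_id].
Qed.

Lemma unit_itv_compact : compact [set: unit_itv R].
Proof.
have -> : [set: unit_itv R] = to_unit @` `[0, 1]%classic.
  apply/seteqP; split=> // s _; exists (\val s); last exact: to_unitK.
  exact: set_valP.
apply: continuous_compact; last exact: segment_compact.
exact/continuous_subspaceT/to_unit_continuous.
Qed.

(** Local compactness of the interval is what makes evaluation of dipaths jointly continuous in the
    compact-open topology. *)
Lemma unit_itv_locally_compact : locally_compact [set: unit_itv R].
Proof.
move=> s _; exists setT; last by split; [exact: unit_itv_compact|exact: closedT].
by rewrite withinET; exact: filterT.
Qed.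

End UnitInterval.

Section DipathSpaces.
Context {R : realType} {n : nat}.
Variables (K : set 'rV[R]_n) (v : 'rV[int]_n).
Local Notation X := (dipaths K (embZ R 0) (embZ R v)).

Definition path_of (alpha : unit_itv R -> K) (t : R) : 'rV[R]_n :=
  \val (alpha (to_unit t)).

Lemma path_of_dipath (alpha : unit_itv R -> K) : X alpha ->
  dipath K v (path_of alpha).
Proof.
case=> _ am a0 a1; split=> [t|i s t st|t t0|t t1].
- exact: set_valP.
- by apply: am => /=; exact: clamp_le.
- have -> : (0 : 'rV[R]_n) = embZ R 0 by rewrite /embZ map_mx0.
  by rewrite /path_of -a0; congr (\val (alpha _)); apply/val_inj; exact: clamp_low.
- by rewrite /path_of -a1; congr (\val (alpha _)); apply/val_inj; exact: clamp_high.
Qed.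

Lemma contR_path_of (alpha : unit_itv R -> K) t i : continuous alpha ->
  contR t (fun t => path_of alpha t 0 i).
Proof.
move=> ca.
apply: (contR_comp (h := path_of alpha) (u := fun y => y 0 i)); last exact: coord_continuous.
apply: (@continuous_comp _ _ _ (alpha \o to_unit) (\val : K -> 'rV[R]_n));
  last exact: initial_continuous.
by apply: continuous_comp; [exact: to_unit_continuous|exact: ca].
Qed.

Lemma dipath_point (b : R -> 'rV[R]_n) : dipath K v b ->
  (forall i t, contR t (fun t => b t 0 i)) ->
  {x : X | forall s, \val ((\val x : unit_itv R -> K) s) = b (\val s)}.
Proof.
move=> [bK bm b0 b1] cb.
have bK' t : b t \in K by exact: mem_set.
pose alpha (s : unit_itv R) : K := exist _ (b (\val s)) (bK' (\val s)).
suff Xa : X alpha by exists (exist _ (alpha : {compact-open, unit_itv R -> K}) (mem_set Xa)).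
split=> [|i s t st||]; last 1 first.
- by rewrite /= b1.
- move=> s; apply: cvg_set_val; apply: (@cvg_row _ _ _ (nbhs s) _ _ (nbhs_filter s)) => i.
  apply: (@contR_comp _ _ _ (\val : unit_itv R -> R) (fun t => b t 0 i)); last exact: cb.
  exact: initial_continuous.
- exact: bm.
- by rewrite /= b0 // /embZ map_mx0.
Qed.

Lemma dipaths_reachable : ~ empty_space X -> reachable K v.
Proof.
move=> ne; apply: contrapT => nr; apply: ne => -[alpha Xa].
have {}Xa : X alpha by exact: set_mem Xa.
apply: nr; exists (path_of alpha); split; first exact: path_of_dipath.
by move=> i t; apply: contR_path_of; case: Xa.
Qed.

Import ArrowAsCompactOpen.

Lemma eval_dipaths_continuous :
  continuous (uncurry (fun (x : X) (s : unit_itv R) => (\val x : unit_itv R -> K) s)).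
Proof.
apply: continuous_uncurry_regular.
- exact: unit_itv_locally_compact.
- exact: uniform_regular.
- exact: initial_continuous.
- by move=> x; case: (set_valP x).
Qed.

(** The parameters are pairs of a dipath and a time [s]. The prescribed family is the dipath itself
    for [s < 1/2] and a fixed dipath [a] for [s > 1/2]; the weight [1 - |4s - 2|] reaches 1 only at
    [s = 1/2] and is negative at both ends. The extended family, curried, is a contraction onto
    [a]. *)
Lemma extensible_contractible : extensible K v -> contractible R X.
Proof.
move=> ext.
have [a [da ca]] := extensible_reachable ext.
pose Z : topologicalType := (X * unit_itv R)%type.
pose sv (z : Z) : R := \val z.2.
have csv z : contR z sv.
  apply: (@continuous_comp _ _ _ snd (\val : unit_itv R -> R)).
    exact: cvg_snd.
  exact: initial_continuous.
pose f (z : Z) : R -> 'rV[R]_n :=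
  if sv z < 2^-1 then path_of (\val z.1) else a.
have [z _||g [[gd gc] gE]] := ext Z setT (fun z => 1 - `|4 * sv z - 2|) f openT.
- apply: contRB; first exact: contR_cst.
  suff ch : contR z (fun z => 4 * sv z - 2).
    by apply: (contR_comp ch (u := fun r : R => `|r|)); exact: norm_continuous.
  apply: contRB; last exact: contR_cst.
  by apply: contRM; [exact: contR_cst|exact: csv].
- split=> [z _|z t i [_ /= wz]].
    rewrite /f; case: ifP => // _; apply: path_of_dipath; exact: set_valP.
  have cs : contR (z, t) (fun p => sv p.1) by apply: contR_fst.
  have [z2|z2] := ltP (sv z) 2^-1.
    apply: (@contR_near _ _ _ _ (fun p : Z * R => path_of (\val p.1.1) p.2 0 i)).
      have : \forall p \near (z, t), sv p.1 < 2^-1.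
        by apply: near_lt => //; exact: contR_cst.
      by apply: filterS => p; rewrite /f => ->.
    apply: (contR_comp (h := fun p : Z * R => path_of (\val p.1.1) p.2)
      (u := fun y => y 0 i)); last exact: coord_continuous.
    pose E := uncurry (fun (x : X) (s : unit_itv R) => (\val x : unit_itv R -> K) s).
    pose h (p : Z * R) : X * unit_itv R := (p.1.1, to_unit p.2).
    apply: (@continuous_comp _ _ _ (E \o h) (\val : K -> 'rV[R]_n));
      last exact: initial_continuous.
    apply: continuous_comp; last exact: eval_dipaths_continuous.
    apply: (@cvg_pair _ _ _ (nbhs (z, t)) (nbhs z.1) (nbhs (to_unit t))).
      apply: (@cvg_comp _ _ _ (fst : Z * R -> Z) (fst : Z -> X) _ (nbhs z));
        exact: cvg_fst.
    apply: (@cvg_comp _ _ _ (snd : Z * R -> R) to_unit _ (nbhs t)); first exact: cvg_snd.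
    exact: to_unit_continuous.
  apply: (@contR_near _ _ _ _ (fun p : Z * R => a p.2 0 i)); last first.
    by apply: (@contR_comp _ _ _ snd (fun t => a t 0 i)); [exact: cvg_snd|exact: ca].
  have {}z2 : 2^-1 < sv z.
    rewrite lt_neqAle z2 andbT; apply: contraTneq wz => <-.
    by rewrite -leNgt (_ : 4 / 2 - 2 = 0) ?normr0 ?subr0 //; lra.
  have : \forall p \near (z, t), 2^-1 < sv p.1.
    by apply: near_lt => //; exact: contR_cst.
  by apply: filterS => p /ltW; rewrite leNgt /f => /negbTE ->.
have gK z t : g z t \in K by rewrite inE; case: (gd z I).
pose F (p : Z * unit_itv R) : K := exist _ (g p.1 (\val p.2)) (gK p.1 (\val p.2)).
have cF : continuous F.
  move=> [z s]; apply: cvg_set_val; apply: cvg_row => i.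
  pose h (p : Z * unit_itv R) : Z * R := (p.1, \val p.2).
  apply: (@contR_comp _ _ _ h (fun q => g q.1 q.2 0 i)); last exact: gc.
  apply: (@cvg_pair _ _ _ (nbhs (z, s)) (nbhs z) (nbhs (\val s : R))).
    exact: cvg_fst.
  apply: (@cvg_comp _ _ _ (snd : Z * unit_itv R -> unit_itv R)
    (\val : unit_itv R -> R) _ (nbhs s)); first exact: cvg_snd.
  exact: initial_continuous.
have point z := dipath_point (gd z I)
  (fun i t => contR_path (F := fun z t => g z t 0 i) (gc z t i I)).
pose H z : X := sval (point z).
have HE z s : \val ((\val (H z) : unit_itv R -> K) s) = g z (\val s).
  exact: (svalP (point z)).
have H_inj z x : (forall s, g z (\val s) = \val ((\val x : unit_itv R -> K) s)) -> H z = x.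
  by move=> e; apply/val_inj/funext => s; apply/val_inj; rewrite HE e.
have [c cE] := dipath_point da ca.
exists c, H; split=> [z|x|x].
- apply: cvg_set_val; have -> : (fun z => \val (H z)) = curry F.
    by apply/funext => z'; apply/funext => s; apply/val_inj; rewrite HE.
  have -> : \val (H z) = curry F z.
    by apply/funext => s; apply/val_inj; rewrite HE.
  exact: continuous_curry_fun.
- apply: H_inj => s; rewrite gE //; last first.
    by rewrite /sv /= subr_le0 ler_normr; apply/orP; right; lra.
  by rewrite /f /sv /= ifT ?invr_gt0 // /path_of to_unitK.
- apply: H_inj => s; rewrite gE //; last first.
    by rewrite /sv /= subr_le0 ler_normr; apply/orP; left; lra.
  by rewrite /f /sv /= ifF ?cE //; apply/negbTE; rewrite -leNgt; lra.
Qed.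

End DipathSpaces.

(** * Reachability of all vertices of a connected complex *)

Section Connected.
Context {R : realType} {n : nat}.
Variable K : set 'rV[R]_n.
Hypothesis K_cubical : cubical_complex K.
Hypothesis K_min : minimal_vertex K 0.
Hypothesis past_links : forall k : 'rV[int]_n, vertices K k ->
  contractible R (realization R (past_link K 0 k)) \/
  empty_space (realization R (past_link K 0 k)).

(** The top vertex of the smallest cube around [x], through which reachability becomes a property of
    arbitrary points of [K]. *)
Definition ceil_vertex (x : 'rV[R]_n) : 'rV[int]_n := \row_i Num.ceil (x 0 i).

Lemma ceil_vertex_embZ (k : 'rV[int]_n) : ceil_vertex (embZ R k) = k.
Proof. by apply/rowP => i; rewrite !mxE intrKceil. Qed.

Lemma vertices_ceil x : K x -> vertices K (ceil_vertex x).
Proof.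
move=> Kx; apply: (carrier_sub K_cubical Kx) => i; rewrite !mxE lexx andbT.
by rewrite ler_int -(ler_int R) (le_trans (floor_le _)) // ceil_ge.
Qed.

(** The top vertex for [y] is [v - S], with [v] that for [x] and [S] in the past link of [v].
    Reachability descends by [reachable_lower] and climbs by [reachable_extend]. *)
Lemma reachable_face (x y : 'rV[R]_n) : K x ->
  (forall i, (Num.floor (x 0 i))%:~R <= y 0 i <= (Num.ceil (x 0 i))%:~R) ->
  reachable K (ceil_vertex x) <-> reachable K (ceil_vertex y).
Proof.
move=> Kx yx; pose v := ceil_vertex x; pose u := ceil_vertex y.
pose S := finset.finset (fun i => u 0 i != v 0 i).
have uE i : Num.floor (x 0 i) <= u 0 i <= v 0 i.
  have /andP[h1 h2] := yx i; rewrite !mxE ceil_le_int h2 andbT.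
  by rewrite -(ler_int R) (le_trans h1) // ceil_ge.
have vE i : v 0 i <= Num.floor (x 0 i) + 1.
  by rewrite mxE ceil_floor lerD2l; case: (x 0 i \isn't a Num.int).
have lE : lower v S = u.
  apply/rowP => i; rewrite lowerE finset.inE.
  have := uE i; have := vE i; case: eqVneq => [->|]; first by rewrite subr0.
  by move=> /eqP ne; rewrite /=; lia.
have LS : past_link K 0 v S.
  apply: (box_link K_min) => z; rewrite lE => zb.
  apply: (carrier_sub K_cubical Kx) => i; have := zb i.
  rewrite ![embZ _ _ _ _]mxE => /andP[uz zv]; apply/andP; split.
    by apply: le_trans uz; rewrite ler_int; case/andP: (uE i).
  by rewrite (le_trans zv) // ler_int mxE.
rewrite -/v -/u -lE; split=> [rv|]; last exact: reachable_extend.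
by apply: reachable_lower => //; exact: vertices_ceil.
Qed.

(** The smallest cube around a point [y] of [K] close to [x] contains [x], so [reachable_face]
    applies with the cube of [y]. *)
Lemma reachable_near (x : 'rV[R]_n) : K x -> \forall y \near x, K y ->
  (reachable K (ceil_vertex y) <-> reachable K (ceil_vertex x)).
Proof.
move=> Kx.
pose V i := [set y : 'rV[R]_n | (Num.ceil (x 0 i) - 1)%:~R < y 0 i
    /\ y 0 i < (Num.floor (x 0 i) + 1)%:~R].
have : nbhs x [set y | forall i, V i y].
  apply: (@filter_forall _ _ V (nbhs x) (nbhs_filter x)) => i.
  have cx : contR x (fun y : 'rV[R]_n => y 0 i).
    exact: coord_continuous.
  have := near_lt cx (@contR_cst _ _ x _) (floorD1_gt (x 0 i)).
  have := near_lt (@contR_cst _ _ x _) cx (ceilB1_lt (x 0 i)).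
  by apply: filterS2 => y; split.
apply: filterS => y yx Ky; apply: reachable_face => // i.
have [h1 h2] := yx i; apply/andP; split.
  rewrite (le_trans _ (floor_le _)) // ler_int -ltzD1.
  by rewrite floor_lt_int.
rewrite (le_trans (ceil_ge _)) // ler_int -ltzD1 -ltrBlDr.
by rewrite ceil_gt_int.
Qed.

(** By [reachable_near], the points with reachable top vertex form a relatively open and closed
    subset of [K], and it contains 0. *)
Lemma connected_reachable k : connected K -> vertices K k -> reachable K k.
Proof.
move=> cK Kk.
pose st x := reachable K (ceil_vertex x).
have K0 : vertices K 0 by case: K_min.
suff E : [set x | K x /\ st x] = K.
  have : [set x | K x /\ st x] (embZ R k) by rewrite E.
  by case=> _; rewrite /st ceil_vertex_embZ.
apply: cK.
- exists (embZ R 0); split=> //; rewrite /st ceil_vertex_embZ.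
  by apply: extensible_reachable; exact: extensible0.
- exists (interior [set x | K x -> st x]); first exact: open_interior.
  apply/seteqP; split=> x [Kx]; last by move=> /interior_subset/(_ Kx).
  move=> sx; split=> //; apply: filterS (reachable_near Kx) => y h Ky.
  by apply/h.
- exists (~` interior [set x | K x -> ~ st x]).
    by apply: open_closedC; exact: open_interior.
  apply/seteqP; split=> x [Kx] => [sx|nx]; split=> //.
    by move=> /interior_subset/(_ Kx).
  apply: contrapT => nsx; apply: nx.
  apply: filterS (reachable_near Kx) => y h Ky sy.
  by apply/nsx/h.
Qed.

End Connected.

(** The conclusion has two parts because dipath spaces can be empty when [K] is disconnected: an
    isolated vertex other than 0 has an empty past link and no dipath from 0. In general each space
    is contractible or empty, and connectedness excludes the empty case. *)
Theorem theorem1 (R : realType) (n : nat) (K : set 'rV[R]_n)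
    (K_cubical : cubical_complex K)
    (K_min : minimal_vertex K 0)
    (past_links : forall k : 'rV[int]_n, vertices K k ->
       contractible R (realization R (past_link K 0 k)) \/
       empty_space (realization R (past_link K 0 k))) :
  (forall k : 'rV[int]_n, vertices K k ->
     contractible R (dipaths K (embZ R 0) (embZ R k)) \/
     empty_space (dipaths K (embZ R 0) (embZ R k))) /\
  (connected K -> forall k : 'rV[int]_n, vertices K k ->
     contractible R (dipaths K (embZ R 0) (embZ R k))).
Proof.
have main k : vertices K k -> reachable K k ->
    contractible R (dipaths K (embZ R 0) (embZ R k)).
  by move=> Kk rk; apply: extensible_contractible; exact: reachable_extensible.
split=> [k Kk|cK k Kk]; last by apply: main => //; exact: connected_reachable.
have [rk|nrk] := pselect (reachable K k); first by left; exact: main.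
by right; apply: contrapT => /dipaths_reachable.
Qed.
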